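(* Let $a$ be a bounded operator on a complex Hilbert space with numerical range $W(a)\subset S_\theta$ for some $\theta<\pi$. Then Newton's method for the square root, $X_{n+1}=\frac12(X_n+X_n^{-1}a)$, with $X_0=1$ or $X_0=(a+1)/2$, converges to the principal square root $a^{1/2}$. Moreover, let $\rho$ be the sectorial angle of $a$ (so $W(a)\subset S_\rho$), let $C_\rho$ be any constant greater than $\sec(\rho/2)$, and let $K$ be Crouzeix's constant. Then for all $n$ large enough, $$\|X_n-a^{1/2}\|<\frac{C_\rho K}{2^n}.$$ In particular, if $a$ is accretive then $\|X_n-a^{1/2}\|\le\frac{K}{2^{n-1}}$ for all $n$ large enough.
   Context: $S_\theta$ is the set of complex numbers with argument in $[-\theta,\theta]$ (together with $0$). $W(a)$ is the closed numerical range, $W(a)=\{\varphi(a):\varphi \text{ a state of } B(H)\}$, i.e. the closure of $\{\langle a\zeta,\zeta\rangle:\|\zeta\|=1\}$. The sectorial angle of $a$ is the least $\rho\in[0,\pi)$ with $W(a)\subset S_\rho$. The operator $a$ is accretive if $W(a)$ lies in the closed right half plane. The principal square root $a^{1/2}$ is the unique square root of $a$ with spectrum in $S_{\pi/2}$ (it exists and is unique since $W(a)$ contains no strictly negative numbers). Crouzeix's constant $K$ is a universal constant with $\|f(x)\|\le K\sup_{z\in W(x)}|f(z)|$ for every bounded Hilbert space operator $x$ and every rational function $f$ with no poles in $W(x)$ (such $K$ exists, by Crouzeix). Convergence is in operator norm; it is part of the claim that the iterates are well defined. How large $n$ must be may depend on $a$ and $C_\rho$.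
   Formalization: The principal square root is taken to be the unique accretive square root of a with spectrum in S_{π/2}; the spectral condition alone does not determine it when 0 is in the spectrum of a (for a=0 on C², every nilpotent b with b²=0 qualifies). *)

(* Defs.v *)
From HB Require Import structures.
From mathcomp Require Import all_boot all_order all_algebra.
From mathcomp Require Import complex.
From mathcomp Require Import all_classical all_reals all_analysis.
Import Order.TTheory GRing.Theory Num.Theory.
Import numFieldNormedType.Exports.

Set Implicit Arguments.
Unset Strict Implicit.
Unset Printing Implicit Defensive.

Local Open Scope classical_set_scope.
Local Open Scope ring_scope.

(* The inner product is linear in its first argument. *)
HB.mixin Record CompleteNormedModule_isHilbert (R : realType) H
    of CompleteNormedModule R[i] H := {
  inner : {dot H for (@Num.conj R[i])} ;
  sqr_norm_inner : forall x : H, `|x| ^+ 2 = inner x x }.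

#[short(type="hilbertType")]
HB.structure Definition Hilbert (R : realType) :=
  {H of CompleteNormedModule R[i] H & CompleteNormedModule_isHilbert R H}.

Section Operators.
Context {R : realType} {H : hilbertType R}.
Implicit Types (a b f g x : H -> H).

Definition bounded_operator f : Prop := linear f /\ continuous f.

(* Norms over R[i] take values in R[i]; complex.Re brings them
   back to R.  The supremum is meaningful for bounded operators only. *)
Definition opnorm f : R :=
  sup [set complex.Re `|f v| | v in [set v : H | `|v| <= 1]].

Definition inverse_operator f g : Prop :=
  [/\ bounded_operator g, cancel f g & cancel g f].

Definition invertible f : Prop :=
  bounded_operator f /\ exists g, inverse_operator f g.

(* The inverse of an invertible operator; an unspecified value otherwise. *)
Definition op_inv f : H -> H := xget f (inverse_operator f).

Definition spectrum f : set R[i] :=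
  [set l | ~ invertible (fun v => f v - l *: v)].

(* The type R[i]^o carries the topology of R[i]. *)
Definition numrange a : set R[i] :=
  closure ([set inner (a v) v | v in [set v : H | `|v| = 1]] : set R[i]^o).

Definition sector (theta : R) : set R[i] :=
  [set z | z = 0 \/ exists r t : R,
     [/\ 0 < r, `|t| <= theta & z = (r * cos t) +i* (r * sin t)]%C].

Definition sectorial_angle a (rho : R) : Prop :=
  [/\ 0 <= rho < pi, numrange a `<=` sector rho &
      forall r : R, 0 <= r < pi -> numrange a `<=` sector r -> rho <= r].

Definition accretive a : Prop := numrange a `<=` [set z | 0 <= complex.Re z].

(* The spectral condition alone does not determine b when 0 is in the spectrum
   of a: for the Volterra operator V, which is accretive, V^(1/2) and -V^(1/2)
   are two square roots of V with spectrum {0}, and on C^2 every b with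
   b^2 = 0 is a square root of 0 with spectrum {0}.  The principal root is the
   accretive one among them. *)
Definition principal_sqrt a b : Prop :=
  [/\ bounded_operator b, b \o b = a, spectrum b `<=` sector (pi / 2) &
      accretive b].

Fixpoint newton a (X0 : H -> H) (n : nat) : H -> H :=
  if n is m.+1 then
    fun v => 2^-1 *: (newton a X0 m v + op_inv (newton a X0 m) (a v))
  else X0.

Definition op_poly (p : {poly R[i]}) x : H -> H :=
  fun v => \sum_(i < size p) p`_i *: iter i x v.

End Operators.

(* A rational function without poles in W(x) is p / q with q nowhere zero on
   W(x); then q(x) is invertible. *)
Definition crouzeix_constant (R : realType) (K : R) : Prop :=
  forall (H : hilbertType R) (x : H -> H) (p q : {poly R[i]}),
    bounded_operator x -> q != 0 ->
    (forall z, numrange x z -> q.[z] != 0) ->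
    opnorm (op_poly p x \o op_inv (op_poly q x))
      <= K * sup [set complex.Re `|p.[z] / q.[z]| | z in numrange x].

(* Main.v *)
Require Import Defs.
From HB Require Import structures.
From mathcomp Require Import all_boot all_order all_algebra.
From mathcomp Require Import complex.
From mathcomp Require Import ring lra.
From mathcomp Require Import all_classical all_reals all_analysis.
Import Order.TTheory GRing.Theory Num.Theory.
Import numFieldNormedType.Exports.
Local Open Scope classical_set_scope.
Local Open Scope ring_scope.

Set Implicit Arguments.
Unset Strict Implicit.
Unset Printing Implicit Defensive.

(* Write [X_n = p_n(a) / q_n(a)], where [p_n(z) / q_n(z)] is the scalar Newton
   iterate [s coth(2^n artanh s)], [s = sqrt z].  By half-angle formulas,
   [a X_n^-1] is the mean of [2 a ((1 + cos t) a + (1 - cos t))^-1] over [2^(n-1)]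
   equidistributed angles [t].  Since [W(a)] lies in a sector of angle [< pi],
   these operators are uniformly bounded, and Lipschitz in [t] with constant
   [O(1 / sin(t/2))]; hence [X_n] converges geometrically to some [b] with
   [b^2 = a], without any use of Crouzeix's constant.  The limit is accretive by
   continuation along [(1 - t) + t a], and an accretive root commuting with all
   other accretive roots is the only one.  For the rate, Crouzeix's inequality
   applied to [X_n - X_m], with [m] tending to infinity, reduces everything to
   the scalar estimate [2^n |p_n(z) / q_n(z) - sqrt z| <= sec(rho / 2)], valid
   for all large [n] uniformly on bounded parts of the sector [S_rho]. *)

(** * Norms and bounded operators *)

Section Norm.
Context {R : realType} {H : hilbertType R}.
Implicit Types (u v w : H) (f g : H -> H).

(** The obstacle is that [a] need not be invertible: 0 may lie in [W(a)], so holomorphic functional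
    calculus does not supply [a^(1/2)], and the resolvents in the average are only bounded by a
    multiple of [1 / (1 - cos t)], which blows up as [t] tends to 0. Two facts tame this. After
    multiplication by [a] the fractions stay bounded in [t]; and in a difference of two of them, one
    of the two powers of [1 / sin(t/2)] cancels against [cos s - cos t]. The remaining singularity
    is repaired by the averaging itself: passing from [t] to [t/2] and [pi - t/2] halves distances,
    the mean contributes another 1/2, and the sum of the two new weights is at most 7/2 times the
    old one. Hence the ratio [1/2 * 1/2 * 7/2 = 7/8] of all limits below. In this part sectoriality
    enters only through the lower bound [c s |v| <= |(a + s) v|] for [s >= 0]; accretivity and
    uniqueness use its quadratic form version. Crouzeix's inequality concerns rational functions,
    which the square root is not; this is why it is applied to differences of iterates. *)

Definition nrm v : R := complex.Re `|v|.
Definition cnrm (z : R[i]) : R := complex.Re `|z|.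

Lemma normE v : `|v| = (nrm v)%:C%C.
Proof.
by rewrite /nrm; have := normr_ge0 v; case: `|v| => x y; rewrite lecE /= => /andP[/eqP -> _].
Qed.

Lemma cnormE (z : R[i]) : `|z| = (cnrm z)%:C%C.
Proof.
by rewrite /cnrm; have := normr_ge0 z; case: `|z| => x y; rewrite lecE /= => /andP[/eqP -> _].
Qed.

Lemma nrm_ge0 v : 0 <= nrm v.
Proof. by have := normr_ge0 v; rewrite normE ler0c. Qed.

Lemma cnrm_ge0 z : 0 <= cnrm z.
Proof. by have := normr_ge0 z; rewrite cnormE ler0c. Qed.

Lemma cnrmE (z : R[i]) : cnrm z ^+ 2 = complex.Re z ^+ 2 + complex.Im z ^+ 2.
Proof. by apply: complexI; rewrite rmorphXn /= -cnormE add_Re2_Im2. Qed.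

Lemma nrm0 : nrm 0 = 0. Proof. by rewrite /nrm normr0. Qed.

Lemma nrm_eq0 v : nrm v = 0 -> v = 0.
Proof. by move=> v0; apply/eqP; rewrite -normr_eq0 normE v0. Qed.

Lemma nrmD u v : nrm (u + v) <= nrm u + nrm v.
Proof. by rewrite -lecR rmorphD /= -!normE ler_normD. Qed.

Lemma nrmZ (l : R[i]) v : nrm (l *: v) = cnrm l * nrm v.
Proof. by apply: complexI; rewrite rmorphM /= -!normE -cnormE normrZ. Qed.

Lemma nrmN v : nrm (- v) = nrm v. Proof. by rewrite /nrm normrN. Qed.

Lemma nrmBC u v : nrm (u - v) = nrm (v - u). Proof. by rewrite -nrmN opprB. Qed.

Lemma nrmB u v w : nrm (u - w) <= nrm (u - v) + nrm (v - w).
Proof. by apply: le_trans (nrmD _ _); rewrite addrA subrK. Qed.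

Lemma cnrmR (x : R) : cnrm x%:C%C = `|x|.
Proof. by rewrite /cnrm normc_def /= expr0n addr0 sqrtr_sqr. Qed.

Lemma cnrmM (x y : R[i]) : cnrm (x * y) = cnrm x * cnrm y.
Proof. by apply: complexI; rewrite rmorphM /= -!cnormE normrM. Qed.

Lemma cnrmD (x y : R[i]) : cnrm (x + y) <= cnrm x + cnrm y.
Proof. by rewrite -lecR rmorphD /= -!cnormE ler_normD. Qed.

Lemma cnrm_eq0 (x : R[i]) : cnrm x = 0 -> x = 0.
Proof. by move=> x0; apply/eqP; rewrite -normr_eq0 cnormE x0. Qed.

Lemma cnrmV (x : R[i]) : cnrm x^-1 = (cnrm x)^-1.
Proof. by apply: complexI; rewrite fmorphV /= -!cnormE normfV. Qed.

Lemma cnrmX (x : R[i]) n : cnrm (x ^+ n) = cnrm x ^+ n.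
Proof. by apply: complexI; rewrite rmorphXn /= -!cnormE normrX. Qed.

Lemma nrmZR (x : R) v : nrm (x%:C%C *: v) = `|x| * nrm v.
Proof. by rewrite nrmZ cnrmR. Qed.

Lemma nrm_half v : nrm (2^-1 *: v) = 2^-1 * nrm v.
Proof.
have -> : (2^-1 : R[i]) = (2^-1 : R)%:C%C by rewrite fmorphV rmorph_nat.
by rewrite nrmZR ger0_norm ?invr_ge0.
Qed.

Lemma nrm_half_sum u v (x y z : R) : nrm u <= x -> nrm v <= y ->
  x + y <= 2 * z -> nrm (2^-1 *: (u + v)) <= z.
Proof. by move=> ux vy xyz; rewrite nrm_half; have := nrmD u v; lra. Qed.

Lemma cvg_nrm (u_ : nat -> H) (l : H) (e : R) : u_ n @[n --> \oo] --> l ->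
  0 < e -> exists N, forall n, (N <= n)%N -> nrm (u_ n - l) < e.
Proof.
move=> /cvgrPdist_lt ul e0.
have /ul [N _ Nu] : (0 : R[i]) < e%:C%C by rewrite -[0]/(0%:C%C) ltcR.
by exists N => n /Nu /=; rewrite normE ltcR nrmBC.
Qed.

Lemma expr_small (k e C : R) : 0 <= k < 1 -> 0 <= C -> 0 < e ->
  exists N, forall n, (N <= n)%N -> C * k ^+ n < e.
Proof.
move=> /andP[k0 k1] C0 e0.
have : (C * k ^+ n @[n --> \oo] --> (0 : R)).
  rewrite -[X in _ --> X](mulr0 C); apply: cvgM; first exact: cvg_cst.
  by apply: cvg_expr; rewrite ger0_norm.
move=> /cvgrPdist_lt /(_ e e0) [N _ Nu]; exists N => n /Nu /=.
by rewrite sub0r normrN ger0_norm // mulr_ge0 // exprn_ge0.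
Qed.

(** The differences telescope to a geometric tail. The explicit rate, and not just the convergence,
    is what the later limit passages use. *)
Lemma geo_cvg (u_ : nat -> H) (D k : R) : 0 <= k < 1 -> 0 <= D ->
  (forall n, nrm (u_ n.+1 - u_ n) <= D * k ^+ n) ->
  exists l, forall n, nrm (u_ n - l) <= D / (1 - k) * k ^+ n.
Proof.
move=> /andP[k0 k1] D0 uD; set C := D / (1 - k).
have C0 : 0 <= C by rewrite divr_ge0 // subr_ge0 ltW.
have CE : C * (1 - k) = D by rewrite /C divfK // subr_eq0 gt_eqF.
clearbody C.
have step n m : nrm (u_ (n + m)%N - u_ n) <= C * (k ^+ n - k ^+ (n + m)).
  elim: m => [|m IH]; first by rewrite addn0 !subrr mulr0 nrm0.
  rewrite addnS; apply: le_trans (nrmB _ (u_ (n + m)%N) _) _.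
  apply: le_trans (lerD (uD _) IH) _; rewrite -CE exprS.
  by rewrite le_eqVlt; apply/orP; left; apply/eqP; ring.
have tail n m : (n <= m)%N -> nrm (u_ m - u_ n) <= C * k ^+ n.
  move=> nm; rewrite -(subnKC nm); apply: le_trans (step _ _) _.
  by rewrite ler_wpM2l // gerBl exprn_ge0.
have /cvg_ex[l ul] : cvgn u_.
  apply: cauchy_cvg; apply: (@cauchy_exP _ _ (u_ @ \oo)) => e e0.
  (* A positive element of [R[i]] is real, so [e] can be replaced by its real part. *)
  have [Ie e'0] : complex.Im e = 0 /\ 0 < complex.Re e.
    by move: e0; rewrite ltcE /= => /andP[/eqP].
  have [N Nu] := expr_small (introT andP (conj k0 k1)) C0 e'0.
  exists (u_ N), N => // n /= Nn.
  rewrite -ball_normE /= normE.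
  have -> : e = (complex.Re e)%:C%C by case: (e) Ie => x y /= ->.
  by rewrite ltcR nrmBC (le_lt_trans (tail _ _ Nn)) // Nu.
exists l => n; apply/ler_addgt0Pr => e e0.
have [N Nu] := cvg_nrm ul e0.
apply: le_trans (nrmB _ (u_ (maxn N n)) _) _; apply: lerD.
  by rewrite nrmBC tail // leq_maxr.
by rewrite ltW // Nu // leq_maxl.
Qed.

End Norm.

Section Linear.
Context {R : realType} {H : hilbertType R}.
Implicit Types (u v w : H) (f g : H -> H).

Section LinTheory.
Context f (fl : linear f).

Lemma linD u v : f (u + v) = f u + f v.
Proof. by have := fl 1 u v; rewrite !scale1r. Qed.
Lemma lin0 : f 0 = 0.
Proof. by apply: (addIr (f 0)); rewrite -linD !add0r. Qed.
Lemma linZ a v : f (a *: v) = a *: f v.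
Proof. by have := fl a v 0; rewrite !addr0 lin0 addr0. Qed.
Lemma linN v : f (- v) = - f v.
Proof. by rewrite -scaleN1r linZ scaleN1r. Qed.
Lemma linB u v : f (u - v) = f u - f v.
Proof. by rewrite linD linN. Qed.
End LinTheory.

(** Explicit bounds keep the supremum in [opnorm] out of the estimates; it appears only where the
    theorem or Crouzeix's inequality asks for it. *)
Definition bnd f (M : R) : Prop := forall v, nrm (f v) <= M * nrm v.

Lemma bnd_le f M M' : bnd f M -> M <= M' -> bnd f M'.
Proof. by move=> fM MM' v; apply: le_trans (fM v) _; rewrite ler_wpM2r ?nrm_ge0. Qed.

Lemma bnd_comp f g M M' : 0 <= M -> bnd f M -> bnd g M' -> bnd (f \o g) (M * M').
Proof.
by move=> M0 fM gM v; apply: le_trans (fM _) _; rewrite -mulrA ler_wpM2l.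
Qed.

Lemma bounded_operator_bnd f : bounded_operator f -> exists2 M, 0 <= M & bnd f M.
Proof.
case=> fl fc; pose F : {linear H -> H} := HB.pack f (GRing.isLinear.Build _ _ _ _ f fl).
have /linear_boundedP [r [rr /(_ (r + 1))]] : bounded_near F (nbhs 0).
  by apply: continuous_linear_bounded; exact: fc.
rewrite ltrDl ltr01 => /(_ isT) /= fb.
have /complex_realP[M rM] : r + 1 \is Num.real by rewrite realD // real1.
exists (Num.max 0 M); first by rewrite le_max lexx.
move=> v; rewrite -lecR rmorphM /= -!normE; apply: le_trans (fb v) _.
by rewrite rM ler_wpM2r // lecR le_max lexx orbT.
Qed.

Lemma bnd_bounded_operator f M : linear f -> bnd f M -> bounded_operator f.
Proof.
move=> fl fM; split=> //.
pose F : {linear H -> H} := HB.pack f (GRing.isLinear.Build _ _ _ _ f fl).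
apply: (@linear_bounded_continuous _ _ _ F).1; apply/linear_boundedP.
exists (M%:C%C); split; first by apply/complex_realP; exists M.
move=> r Mr v /=; apply: (@le_trans _ _ (M%:C%C * `|v|)).
  by rewrite !normE -rmorphM lecR.
by rewrite ler_wpM2r // ltW.
Qed.

Lemma linear_id : linear (fun v : H => v). Proof. by []. Qed.
Lemma linear_add f g : linear f -> linear g -> linear (f \+ g).
Proof. by move=> fl gl a u v /=; rewrite fl gl scalerDr addrACA. Qed.
Lemma linear_scale (l : R[i]) f : linear f -> linear (l \*: f).
Proof. by move=> fl a u v /=; rewrite fl scalerDr !scalerA mulrC. Qed.
Lemma linear_comp f g : linear f -> linear g -> linear (f \o g).
Proof. by move=> fl gl a u v /=; rewrite gl fl. Qed.

Lemma opnorm_le f M : 0 <= M -> bnd f M -> opnorm f <= M.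
Proof.
move=> M0 fM; apply: ge_sup.
  by exists (nrm (f 0)), 0 => //=; rewrite normr0.
move=> _ [v /= v1 <-]; apply: le_trans (fM v) _.
by rewrite ler_piMr // -lecR -normE.
Qed.

Lemma bnd_opnorm f : bounded_operator f -> bnd f (opnorm f).
Proof.
move=> fb; have [M M0 fM] := bounded_operator_bnd fb; have fl := fb.1.
move=> v; have [v0|v0] := eqVneq (nrm v) 0.
  by rewrite (nrm_eq0 v0) (lin0 fl) nrm0 mulr0.
have vp : 0 < nrm v by rewrite lt_def v0 nrm_ge0.
rewrite -ler_pdivrMr // mulrC; apply: ub_le_sup.
  exists M => _ [u /= u1 <-]; apply: le_trans (fM u) _.
  by rewrite ler_piMr // -lecR -normE.
exists ((nrm v)^-1%:C%C *: v) => /=.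
  by rewrite normE nrmZR lecR ger0_norm ?invr_ge0 ?nrm_ge0 // mulVf.
by rewrite (linZ fl) -/(nrm _) nrmZR ger0_norm ?invr_ge0 ?nrm_ge0.
Qed.

Lemma opnorm_ge0 f : bounded_operator f -> 0 <= opnorm f.
Proof.
move=> fb; have [M M0 fM] := bounded_operator_bnd fb.
apply: le_trans (nrm_ge0 (f 0)) _; apply: ub_le_sup.
  exists M => _ [u /= u1 <-]; apply: le_trans (fM u) _.
  by rewrite ler_piMr // -lecR -normE.
by exists 0 => //=; rewrite normr0.
Qed.

End Linear.

(** * Inner product and resolvents *)

Section InnerProduct.
Context {R : realType} {H : hilbertType R}.
Implicit Types (u v w : H) (f g a : H -> H).

Definition ip u v : R := complex.Re (inner u v).

Lemma innDl u v w : inner (u + v) w = inner u w + inner v w.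
Proof. exact: linearDl. Qed.
Lemma innZl (l : R[i]) u v : inner (l *: u) v = l * inner u v.
Proof. exact: linearZl_LR. Qed.
Lemma innDr u v w : inner w (u + v) = inner w u + inner w v.
Proof. exact: linearDr. Qed.
Lemma innZr (l : R[i]) u v : inner u (l *: v) = (l^*)%C * inner u v.
Proof. exact: linearZr_LR. Qed.
Lemma innC u v : inner u v = ((inner v u)^*)%C.
Proof. by rewrite (hermC inner u v) expr0 mul1r. Qed.
Lemma inn_norm v : inner v v = (nrm v ^+ 2)%:C%C.
Proof. by rewrite -sqr_norm_inner normE rmorphXn. Qed.

Lemma ReD (x y : R[i]) : complex.Re (x + y) = complex.Re x + complex.Re y.
Proof. by case: x y => ? ? []. Qed.
Lemma ImD (x y : R[i]) : complex.Im (x + y) = complex.Im x + complex.Im y.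
Proof. by case: x y => ? ? []. Qed.
Lemma ReM (x y : R[i]) :
  complex.Re (x * y) = complex.Re x * complex.Re y - complex.Im x * complex.Im y.
Proof. by case: x y => ? ? []. Qed.
Lemma ReR (x : R) (y : R[i]) : complex.Re (x%:C%C * y) = x * complex.Re y.
Proof. by rewrite ReM /= mul0r subr0. Qed.
Lemma ipC u v : ip u v = ip v u.
Proof. by rewrite /ip innC; case: (inner v u). Qed.
Lemma ipDl u v w : ip (u + v) w = ip u w + ip v w.
Proof. by rewrite /ip innDl ReD. Qed.
Lemma ipDr u v w : ip w (u + v) = ip w u + ip w v.
Proof. by rewrite /ip innDr ReD. Qed.
Lemma ipZl (l : R) u v : ip (l%:C%C *: u) v = l * ip u v.
Proof. by rewrite /ip innZl ReR. Qed.
Lemma ipZr (l : R) u v : ip u (l%:C%C *: v) = l * ip u v.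
Proof. by rewrite ipC ipZl ipC. Qed.
Lemma ipNl u v : ip (- u) v = - ip u v.
Proof. by rewrite -scaleN1r -[-1](rmorphN1 (real_complex R)) ipZl mulN1r. Qed.
Lemma ipNr u v : ip u (- v) = - ip u v.
Proof. by rewrite ipC ipNl ipC. Qed.
Lemma ip_norm v : ip v v = nrm v ^+ 2.
Proof. by rewrite /ip inn_norm. Qed.
Lemma ipil u v : ip ('i%C *: u) v = - complex.Im (inner u v).
Proof. by rewrite /ip innZl ReM /= mul0r mul1r sub0r. Qed.
Lemma ipir u v : ip u ('i%C *: v) = complex.Im (inner u v).
Proof. by rewrite ipC ipil innC; case: (inner u v) => x y /=; rewrite opprK. Qed.

(** Cauchy-Schwarz: [N u - d v] is the component of [u] orthogonal to [v], cleared of the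
    denominator [N = |v|^2], and its squared norm is expanded. *)
Lemma inner_bound u v : cnrm (inner u v) <= nrm u * nrm v.
Proof.
have [v0|v0] := eqVneq (nrm v) 0.
  by rewrite (nrm_eq0 v0) linear0r /cnrm normr0 /= mulr_ge0 ?nrm_ge0.
have vp : 0 < nrm v by rewrite lt_def v0 nrm_ge0.
set d := inner u v; set N := nrm v ^+ 2; have Np : 0 < N by rewrite exprn_gt0.
have : 0 <= nrm (N%:C%C *: u - d *: v) ^+ 2 by rewrite sqr_ge0.
have dd : ip u (d *: v) = cnrm d ^+ 2.
  rewrite /ip innZr -/d cnrmE; case: (d) => x y; rewrite ReM /= mulNr opprK.
  by rewrite !expr2.
rewrite -ip_norm ipDl !ipDr !ipNl !ipNr !ipZl !ipZr opprK (ipC (d *: v) u) dd.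
rewrite !ip_norm nrmZ exprMn -/N.
move=> h; have : cnrm d ^+ 2 <= (nrm u * nrm v) ^+ 2.
  rewrite exprMn -/N -(ler_pM2l Np); lra.
by rewrite ler_pXn2r // nnegrE ?cnrm_ge0 ?mulr_ge0 ?nrm_ge0.
Qed.

Lemma ip_bound u v : `|ip u v| <= nrm u * nrm v.
Proof.
apply: le_trans (inner_bound u v); rewrite -(ler_pXn2r (n := 2)) ?nnegrE ?cnrm_ge0 //.
by rewrite real_normK ?num_real // cnrmE lerDl sqr_ge0.
Qed.

End InnerProduct.

Section Resolvent.
Context {R : realType} {H : hilbertType R}.
Implicit Types (u v w : H) (f g a e : H -> H).

Lemma le0_geo (x k C : R) : 0 <= k < 1 -> 0 <= C ->
  (forall n, x <= C * k ^+ n) -> x <= 0.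
Proof.
move=> k01 C0 xC; apply/ler_addgt0Pr => e e0; rewrite add0r.
by have [N /(_ N (leqnn N)) /ltW] := expr_small k01 C0 e0; exact: le_trans.
Qed.

(** Neumann series, run as the fixed point iteration [x -> g (y - e x)], a contraction of ratio
    [be * ep]. As [g] is a right inverse of [f], the fixed point solves [f x = y - e x]. *)
Lemma perturb_surj f g e (be ep : R) : linear f -> linear g -> linear e ->
  cancel g f -> 0 <= be -> 0 <= ep -> bnd g be -> bnd e ep -> be * ep < 1 ->
  forall y, exists x, f x + e x = y.
Proof.
move=> fl gl el gK be0 ep0 gb eb k1 y; set k := be * ep.
have k01 : 0 <= k < 1 by rewrite mulr_ge0.
pose x_ n := iter n (fun x => g (y - e x)) 0.
have geb v : nrm (g (e v)) <= k * nrm v by apply: (bnd_comp be0 gb eb).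
have st u v : g (y - e u) - g (y - e v) = - g (e (u - v)).
  by rewrite -(linB gl) -(linN gl) (linB el); congr g; rewrite opprB addrC addrA subrK opprB.
have [l xl] : exists l, forall n,
    nrm (x_ n - l) <= nrm (x_ 1%N - x_ 0) / (1 - k) * k ^+ n.
  apply: geo_cvg => //; first exact: nrm_ge0.
  elim=> [|n IH]; first by rewrite expr0 mulr1.
  rewrite [x_ n.+2]/= [X in _ - X]/= st nrmN; apply: le_trans (geb _) _.
  by rewrite exprS mulrCA ler_wpM2l //; case/andP: k01.
set C := nrm (x_ 1%N - x_ 0) / (1 - k) in xl.
have C0 : 0 <= C by rewrite divr_ge0 ?nrm_ge0 // subr_ge0 ltW.
have lE : l = g (y - e l).
  apply/eqP; rewrite -subr_eq0; apply/eqP/nrm_eq0/le_anti.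
  rewrite nrm_ge0 andbT; apply: (@le0_geo _ k (C + C)) => // [|n]; first exact: addr_ge0.
  apply: le_trans (nrmB _ (x_ n.+1) _) _; rewrite mulrDl; apply: lerD.
    rewrite nrmBC; apply: le_trans (xl _) _; rewrite ler_wpM2l // exprS ler_piMl //.
      by rewrite exprn_ge0 //; case/andP: k01.
    by case/andP: k01 => _ /ltW.
  rewrite [x_ n.+1]/= st nrmN; apply: le_trans (geb _) _.
  have [k0 /ltW k1'] := andP k01.
  by apply: le_trans (xl n); rewrite ler_piMl // nrm_ge0.
by exists l; rewrite {1}lE gK subrK.
Qed.

Lemma inverse_of_lower_bound f (m : R) : linear f -> 0 < m ->
  (forall v, m * nrm v <= nrm (f v)) -> (forall y, exists x, f x = y) ->
  exists2 g, inverse_operator f g & bnd g m^-1.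
Proof.
move=> fl m0 fm /choice[g gK].
have f0 v : f v = 0 -> v = 0.
  move=> fv; apply: nrm_eq0; apply/le_anti; rewrite nrm_ge0 andbT.
  by have := fm v; rewrite fv nrm0 pmulr_rle0.
have finj u v : f u = f v -> u = v.
  by move=> uv; apply/eqP; rewrite -subr_eq0; apply/eqP/f0; rewrite (linB fl) uv subrr.
have gb : bnd g m^-1.
  by move=> v; rewrite -(ler_pM2l m0) mulrA mulfV ?gt_eqF // mul1r -{2}(gK v).
have gl : linear g by move=> l u v; apply: finj; rewrite fl !gK.
exists g => //; split; [exact: bnd_bounded_operator gb | | exact: gK].
by move=> v; apply: finj; rewrite gK.
Qed.

(** The form in which sectoriality controls resolvents, with one constant for all [s]. For a sector
    of angle [theta] the constant is [1 + min (cos theta) 0]. *)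
Definition lower_sect (c : R) a := forall s v, 0 <= s ->
  c * s * nrm v <= nrm (a v + s%:C%C *: v).

(** The lower bound makes [a + s] injective with a bounded inverse on its range; surjectivity is
    carried down from large [s], where the Neumann series converges, by shrinking [s] repeatedly by
    a fixed ratio. The admissible ratio does not depend on [s], so every positive [s] is reached. *)
Lemma resolvent a (M c : R) : linear a -> 0 <= M -> bnd a M -> 0 < c <= 1 ->
  lower_sect c a -> forall s : R, 0 < s ->
  exists2 g, inverse_operator (fun v => a v + s%:C%C *: v) g & bnd g (c * s)^-1.
Proof.
move=> al M0 aM /andP[c0 c1] ac.
pose A s v := a v + s%:C%C *: v.
have Al s : linear (A s).
  by apply: linear_add => //; apply: linear_scale; exact: linear_id.
have sl s : linear (fun v : H => s *: v) by apply: linear_scale; exact: linear_id.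
have sb (s : R) : bnd (fun v : H => s%:C%C *: v) `|s| by move=> v; rewrite nrmZR.
have inv s : 0 < s -> (forall y, exists x, A s x = y) ->
    exists2 g, inverse_operator (A s) g & bnd g (c * s)^-1.
  move=> s0; apply: inverse_of_lower_bound => //; first by rewrite mulr_gt0.
  by move=> v; apply: ac; exact: ltW.
(* Going from [s / q] to [s] perturbs by [(c / 2) (s / q)], half the lower bound at [s / q], so the
   Neumann ratio is 1/2. *)
pose q := 1 - c / 2.
have q0 : 0 < q by rewrite /q; lra.
have q1 : q < 1 by rewrite /q; lra.
have surj n : forall s : R, (M + 1) * q ^+ n <= s -> forall y, exists x, A s x = y.
  elim: n => [|n IH] s.
    rewrite expr0 mulr1 => Ms; have s0 : 0 < s by lra.
    move=> y; have [||||x <-] := @perturb_surj (fun v => s%:C%C *: v)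
      (fun v => s^-1%:C%C *: v) a s^-1 M (sl _) (sl _) al _ _ M0 _ aM _ y.
    - by move=> v; rewrite scalerA -rmorphM mulfV ?gt_eqF // scale1r.
    - by rewrite invr_ge0 ltW.
    - by move=> v; rewrite nrmZR ger0_norm // invr_ge0 ltW.
    - by rewrite mulrC ltr_pdivrMr //; lra.
    by exists x; rewrite addrC.
  rewrite exprSr mulrA -ler_pdivlMr // => qs y.
  have sq0 : 0 < s / q.
    by apply: lt_le_trans qs; rewrite mulr_gt0 ?exprn_gt0 //; lra.
  have [g [gb _ gK] gB] := inv _ sq0 (IH _ qs).
  have [|||x <-] := @perturb_surj (A (s / q)) g
      (fun v => (s - s / q)%:C%C *: v) (c * (s / q))^-1 `|s - s / q|
      (Al _) gb.1 (sl _) gK _ _ gB (sb _) _ y.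
  - by rewrite invr_ge0 mulr_ge0 // ltW.
  - exact: normr_ge0.
  - have -> : s - s / q = - ((c / 2) * (s / q)).
      by rewrite {1}(_ : s = q * (s / q)) /q; [ring|rewrite mulrC divfK // gt_eqF].
    rewrite normrN gtr0_norm; last by rewrite mulr_gt0 // divr_gt0.
    have -> : (c * (s / q))^-1 * (c / 2 * (s / q)) = 2^-1; last by lra.
    move: (s / q) sq0 => t t0; field.
    by rewrite !gt_eqF.
  by exists x; rewrite /A -addrA -scalerDl -rmorphD /= [s / q + _]addrC subrK.
move=> s s0; apply: inv => //.
have [N /(_ N (leqnn N)) /ltW] := @expr_small R q s (M + 1)
  (introT andP (conj (ltW q0) q1)) (addr_ge0 M0 ler01) s0.
exact: surj.
Qed.

End Resolvent.

(** * Rational functions of an operator *)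

Section OperatorPolynomials.
Context {R : realType} {H : hilbertType R}.
Implicit Types (u v w : H) (f g a x : H -> H) (p q : {poly R[i]}).

Lemma op_polyE n p x v : (size p <= n)%N ->
  op_poly p x v = \sum_(i < n) p`_i *: iter i x v.
Proof.
move=> pn; rewrite /op_poly (big_ord_widen n (fun i => p`_i *: iter i x v) pn).
rewrite big_mkcond /=; apply: eq_bigr => i _; case: ltnP => // ip.
by rewrite nth_default // scale0r.
Qed.

Lemma op_polyD p q x v : op_poly (p + q) x v = op_poly p x v + op_poly q x v.
Proof.
pose n := maxn (size p) (size q).
rewrite !(@op_polyE n) ?leq_maxl ?leq_maxr ?size_polyD //.
by rewrite -big_split; apply: eq_bigr => i _; rewrite coefD scalerDl.
Qed.

Lemma op_polyC (l : R[i]) x v : op_poly l%:P x v = l *: v.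
Proof. by rewrite (@op_polyE 1) ?size_polyC_leq1 // big_ord1 coefC. Qed.

Lemma op_poly1 x v : op_poly 1 x v = v.
Proof. by rewrite op_polyC scale1r. Qed.

Lemma op_polyMX p x v : op_poly (p * 'X) x v = op_poly p x (x v).
Proof.
rewrite (@op_polyE (size p).+1); last first.
  by apply: leq_trans (size_polyMleq _ _) _; rewrite size_polyX addn2.
rewrite big_ord_recl coefMX /= scale0r add0r; apply: eq_bigr => i _.
by rewrite coefMX /= -iterS iterSr.
Qed.

Lemma op_polyX x v : op_poly 'X x v = x v.
Proof. by rewrite -['X]mul1r op_polyMX op_poly1. Qed.

Lemma op_poly_commute f p x v : linear f -> (forall v, f (x v) = x (f v)) ->
  f (op_poly p x v) = op_poly p x (f v).
Proof.
move=> fl fx; elim/poly_ind: p v => [|p l IH] v.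
  by rewrite -[0]/(0%:P) !op_polyC !scale0r (lin0 fl).
by rewrite !op_polyD !op_polyMX !op_polyC (linD fl) (linZ fl) IH fx.
Qed.

Section FunctionalCalculus.
Context x (xb : bounded_operator x).

Lemma bounded_op_poly p : bounded_operator (op_poly p x).
Proof.
have xl := xb.1; have [M M0 xM] := bounded_operator_bnd xb.
suff [pl [N N0 pN]] : linear (op_poly p x) /\
    exists2 N, 0 <= N & bnd (op_poly p x) N by exact: bnd_bounded_operator pN.
elim/poly_ind: p => [|p l [pl [N N0 pN]]].
  split=> [a u v|]; first by rewrite -[0]/(0%:P) !op_polyC !scale0r addr0 scaler0.
  by exists 0 => // v; rewrite op_polyC scale0r nrm0 mul0r.
have E v : op_poly (p * 'X + l%:P) x v = op_poly p x (x v) + l *: v.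
  by rewrite op_polyD op_polyMX op_polyC.
split=> [a u v|].
  by rewrite !E xl pl !scalerDr addrACA scalerA mulrC -scalerA.
exists (N * M + cnrm l) => [|v]; first by rewrite addr_ge0 ?mulr_ge0 ?cnrm_ge0.
rewrite E; apply: le_trans (nrmD _ _) _; rewrite mulrDl nrmZ lerD2r.
exact: (bnd_comp N0 pN xM).
Qed.

Lemma op_polyZ (l : R[i]) q v : op_poly (l%:P * q) x v = l *: op_poly q x v.
Proof.
elim/poly_ind: q v => [|q m IHq] v.
  by rewrite mulr0 -[0]/(0%:P) !op_polyC !scale0r scaler0.
have -> : l%:P * (q * 'X + m%:P) = l%:P * q * 'X + (l * m)%:P by rewrite polyCM; ring.
by rewrite !op_polyD !op_polyMX !op_polyC IHq scalerDr scalerA.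
Qed.

Lemma op_polyN q v : op_poly (- q) x v = - op_poly q x v.
Proof.
apply/eqP; rewrite -subr_eq0 opprK -op_polyD addNr.
by rewrite -[0]/(0%:P) op_polyC scale0r.
Qed.

Lemma op_polyM p q v : op_poly (p * q) x v = op_poly p x (op_poly q x v).
Proof.
elim/poly_ind: p v => [|p l IH] v.
  by rewrite mul0r -[0]/(0%:P) !op_polyC !scale0r.
have -> : (p * 'X + l%:P) * q = (p * q) * 'X + l%:P * q by ring.
rewrite !op_polyD !op_polyMX op_polyC IH.
have xl := xb.1.
congr (_ + _); first by congr (op_poly p x _); rewrite (op_poly_commute (f := x)).
exact: op_polyZ.
Qed.

Definition regular p := invertible (op_poly p x).

Lemma op_invP f : invertible f -> inverse_operator f (op_inv f).
Proof. by case=> _ fi; exact: xgetPex. Qed.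

Lemma op_inv_unique f g : inverse_operator f g -> op_inv f = g.
Proof.
move=> fg; have [_ fK Kf] := fg.
apply: xget_unique => // h [_ fh hf]; apply/funext => v.
by rewrite -{1}(Kf v) fh.
Qed.

Lemma op_poly_comm p q v : op_poly p x (op_poly q x v) = op_poly q x (op_poly p x v).
Proof. by rewrite -!op_polyM mulrC. Qed.

Lemma bounded_comp f g : bounded_operator f -> bounded_operator g ->
  bounded_operator (f \o g).
Proof.
move=> fb gb; have [M M0 fM] := bounded_operator_bnd fb.
have [N N0 gN] := bounded_operator_bnd gb.
exact: bnd_bounded_operator (linear_comp fb.1 gb.1) (bnd_comp M0 fM gN).
Qed.

Lemma inverse_comp f f' g g' : inverse_operator f g -> inverse_operator f' g' ->
  inverse_operator (f \o f') (g' \o g).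
Proof.
move=> [gb fK Kf] [gb' fK' Kf']; split; first exact: bounded_comp.
  by move=> v /=; rewrite fK fK'.
by move=> v /=; rewrite Kf' Kf.
Qed.

Lemma regularM p q : regular p -> regular q -> regular (p * q).
Proof.
move=> pr qr; split; first exact: bounded_op_poly.
exists (op_inv (op_poly q x) \o op_inv (op_poly p x)).
have := inverse_comp (op_invP pr) (op_invP qr).
by congr inverse_operator; apply/funext => v /=; rewrite op_polyM.
Qed.

Lemma regularC (l : R[i]) : l != 0 -> regular l%:P.
Proof.
move=> l0; split; first exact: bounded_op_poly.
exists (op_poly l^-1%:P x); split; first exact: bounded_op_poly.
  by move=> v; rewrite !op_polyC scalerA mulVf // scale1r.
by move=> v; rewrite !op_polyC scalerA mulfV // scale1r.
Qed.

Definition opfrac p q : H -> H := op_poly p x \o op_inv (op_poly q x).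

Lemma regular_surj q v : regular q -> exists u, v = op_poly q x u.
Proof. by move=> /op_invP[_ _ qK]; exists (op_inv (op_poly q x) v). Qed.

Lemma opfrac_op p q u : regular q -> opfrac p q (op_poly q x u) = op_poly p x u.
Proof. by move=> /op_invP[_ qK _]; rewrite /opfrac /= qK. Qed.

(** The denominators being invertible, every vector has the form [q(x) q'(x) u], and on such vectors
    fractions become polynomials. The same substitution proves the sum and product rules below. *)
Lemma opfrac_eq p q p' q' : regular q -> regular q' -> p * q' = p' * q ->
  opfrac p q = opfrac p' q'.
Proof.
move=> qr qr' E; apply/funext => v; have [u ->] := regular_surj v (regularM qr qr').
rewrite {1}op_polyM opfrac_op // mulrC op_polyM opfrac_op //.
by rewrite -!op_polyM E.
Qed.

Lemma opfracD p q p' q' v : regular q -> regular q' ->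
  opfrac p q v + opfrac p' q' v = opfrac (p * q' + p' * q) (q * q') v.
Proof.
move=> qr qr'; have [u ->] := regular_surj v (regularM qr qr').
rewrite opfrac_op; last exact: regularM.
rewrite op_polyD !op_polyM; congr (_ + _); first by rewrite opfrac_op.
by rewrite op_poly_comm opfrac_op.
Qed.

Lemma opfracM p q p' q' v : regular q -> regular q' ->
  opfrac p q (opfrac p' q' v) = opfrac (p * p') (q * q') v.
Proof.
move=> qr qr'; have [u ->] := regular_surj v (regularM qr qr').
rewrite opfrac_op; last exact: regularM.
by rewrite !op_polyM (op_poly_comm q q') opfrac_op // (op_poly_comm p' q) opfrac_op.
Qed.

Lemma opfracZ l p q v : l *: opfrac p q v = opfrac (l%:P * p) q v.
Proof. by rewrite /opfrac /= op_polyM op_polyC. Qed.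

Lemma opfrac_opp p q v : - opfrac p q v = opfrac (- p) q v.
Proof. by rewrite -scaleN1r opfracZ polyCN mulN1r. Qed.

Lemma opfracB p q p' q' v : regular q -> regular q' ->
  opfrac p q v - opfrac p' q' v = opfrac (p * q' - p' * q) (q * q') v.
Proof. by move=> qr qr'; rewrite opfrac_opp opfracD // mulNr. Qed.

Lemma opfrac_inverse p q : regular p -> regular q ->
  inverse_operator (opfrac p q) (opfrac q p).
Proof.
move=> pr qr; split.
- by apply: bounded_comp; [exact: bounded_op_poly|case: (op_invP pr)].
- move=> v; have [u ->] := regular_surj v qr; by rewrite opfrac_op // opfrac_op.
- move=> v; have [u ->] := regular_surj v pr; by rewrite opfrac_op // opfrac_op.
Qed.

Lemma bounded_opfrac p q : regular q -> bounded_operator (opfrac p q).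
Proof.
by move=> qr; apply: bounded_comp; [exact: bounded_op_poly|case: (op_invP qr)].
Qed.

Lemma opfrac_commute f p q v : linear f -> (forall v, f (x v) = x (f v)) -> regular q ->
  f (opfrac p q v) = opfrac p q (f v).
Proof.
move=> fl fx qr; have [u ->] := regular_surj v qr.
by rewrite opfrac_op // (op_poly_commute _ _ fl fx) (op_poly_commute _ _ fl fx) opfrac_op.
Qed.

End FunctionalCalculus.

End OperatorPolynomials.

(** * Newton iterates as rational functions *)

Section NewtonPolynomials.
Context {R : realType}.
Implicit Types c : R.

Fixpoint newton_pair n : {poly R[i]} * {poly R[i]} :=
  if n is m.+1 then
    let: (p, q) := newton_pair m in (p ^+ 2 + 'X * q ^+ 2, 2%:R * p * q)
  else (1, 1).

Definition nump n := (newton_pair n).1.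
Definition denp n := (newton_pair n).2.

Lemma numpS n : nump n.+1 = nump n ^+ 2 + 'X * denp n ^+ 2.
Proof. by rewrite /nump /denp /=; case: newton_pair. Qed.

Lemma denpS n : denp n.+1 = 2%:R * nump n * denp n.
Proof. by rewrite /nump /denp /=; case: newton_pair. Qed.

(** With [s] a square root of [z], [nump n + s denp n] is [(1 + s)^(2^n)], and likewise with [- s];
    this is the product of the two identities, free of the root. *)
Lemma pell n : nump n ^+ 2 - 'X * denp n ^+ 2 = (1 - 'X) ^+ (2 ^ n).
Proof.
elim: n => [|n IH]; first by rewrite /nump /denp /=; ring.
by rewrite numpS denpS expnS mulnC exprM -IH; ring.
Qed.

(* [x_n = nump n.+1 / (1 - 'X) ^+ (2 ^ n)] obeys the Chebyshev recursion
   [x_{n+1} = 2 x_n^2 - 1], so [x_n - c] factors through the half angle of [c]. *)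
Definition shifted n c : {poly R[i]} :=
  nump n.+1 - c%:C%C%:P * (1 - 'X) ^+ (2 ^ n).

Lemma shifted0 c : shifted 0 c = (1 + c)%:C%C%:P * 'X + (1 - c)%:C%C%:P.
Proof.
rewrite /shifted numpS /nump /denp /= expn0 expr1 rmorphB rmorphD rmorph1 /=.
rewrite polyCB polyCD; ring.
Qed.

Lemma shiftedN0 n : shifted n 0 = nump n.+1.
Proof. by rewrite /shifted mul0r subr0. Qed.

Lemma shiftedS n c d : 2 * d ^+ 2 = 1 + c ->
  shifted n.+1 c = 2%:R * shifted n d * shifted n (- d).
Proof.
move=> dc; rewrite /shifted (numpS n.+1).
have -> : c = 2 * d ^+ 2 - 1 by rewrite dc addrC addKr.
have := pell n.+1; rewrite [(2 ^ n.+1)%N]expnS mulnC exprM.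
move: (nump n.+1) (denp n.+1) ((1 - 'X) ^+ (2 ^ n)) => P Q D PQ.
have -> : 'X * Q ^+ 2 = P ^+ 2 - D ^+ 2 by rewrite -PQ; ring.
rewrite rmorphB rmorphM rmorphXn rmorph_nat rmorph1 rmorphN /= polyCB polyCN polyCM polyC_exp.
rewrite -[2%:R%:P]/(2%:R%:R%:P).
have -> : (2 : R[i])%:P = 2%:R by rewrite polyC_natr.
by ring.
Qed.

Lemma shifted_sum n d : shifted n d + shifted n (- d) = 2%:R * nump n.+1.
Proof. by rewrite /shifted rmorphN polyCN; ring. Qed.

End NewtonPolynomials.

Section NewtonOperators.
Context {R : realType} {H : hilbertType R} (a : H -> H) (M c : R).
Hypotheses (al : linear a) (M0 : 0 <= M) (aM : bnd a M) (c01 : 0 < c <= 1)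
  (ac : lower_sect c a).
Implicit Types (u v : H) (t al be : R).

Let ab : bounded_operator a := bnd_bounded_operator al aM.

(** The polynomial is [t (X + s / t)]; the factor [t] cancels in the bound, which therefore does not
    deteriorate for small [t]. *)
Lemma regular_lin (t s : R) : 0 < t -> 0 < s ->
  regular a (t%:C%C%:P * 'X + s%:C%C%:P) /\
  bnd (op_inv (op_poly (t%:C%C%:P * 'X + s%:C%C%:P) a)) (c * s)^-1.
Proof.
move=> t0 s0; have st0 : 0 < s / t by rewrite divr_gt0.
have [g [gb gK Kg] gB] := resolvent al M0 aM c01 ac st0.
set f := op_poly _ _.
have fE v : f v = t%:C%C *: (a v + (s / t)%:C%C *: v).
  rewrite /f op_polyD op_polyMX !op_polyC scalerDr scalerA -rmorphM.
  by rewrite [t * _]mulrC divfK // gt_eqF.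
have tV : t%:C%C * (t^-1)%:C%C = 1 :> R[i] by rewrite -rmorphM mulfV ?gt_eqF.
pose h v := (t^-1)%:C%C *: g v.
have hb : bnd h (c * s)^-1.
  move=> v; rewrite nrmZR ger0_norm; last by rewrite invr_ge0 ltW.
  apply: (le_trans (ler_wpM2l _ (gB v))); first by rewrite invr_ge0 ltW.
  rewrite (mulrA t^-1) ler_wpM2r ?nrm_ge0 //.
  have -> : t^-1 * (c * (s / t))^-1 = (c * s)^-1; last by [].
  have /andP[c0 _] := c01; field; by rewrite !gt_eqF.
have fh : inverse_operator f h.
  split; first by apply: bnd_bounded_operator hb; apply: linear_scale; case: gb.
    move=> v; rewrite fE /h (linZ gb.1) scalerA mulrC tV scale1r; exact: gK.
  by move=> v; rewrite fE /h (linZ al) scalerA mulrC -scalerA -scalerDr scalerA tV scale1r Kg.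
split; last by rewrite (op_inv_unique fh).
by split; [exact: bounded_op_poly|exists h].
Qed.

Lemma cos_half_sq (t : R) : 2 * cos (t / 2) ^+ 2 = 1 + cos t.
Proof. by rewrite {2}(splitr t) -mulr2n cos_mulr2n; ring. Qed.

Lemma half_range (t : R) : 0 < t < pi -> 0 < t / 2 < pi /\ 0 < pi - t / 2 < pi.
Proof. by move=> /andP[t0 t1]; split; apply/andP; split; lra. Qed.

Lemma cos_piB (t : R) : cos (pi - t) = - cos t.
Proof. by rewrite addrC cosDpi cosN. Qed.

Lemma shifted_cosS n t : shifted n.+1 (cos t) =
  2%:R * shifted n (cos (t / 2)) * shifted n (cos (pi - t / 2)).
Proof. by rewrite cos_piB; apply/shiftedS/cos_half_sq. Qed.

Lemma cos_lt1 t : 0 < t < pi -> 0 < 1 + cos t /\ 0 < 1 - cos t.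
Proof.
move=> /andP[t0 t1]; split.
  rewrite -ltrBlDl sub0r -cospi ltr_cos ?in_itv /= ?pi_ge0 ?lexx ?ltW //.
by rewrite subr_gt0 -cos0 ltr_cos ?in_itv /= ?pi_ge0 ?lexx ?ltW.
Qed.

Lemma regular_nat n : regular a n.+1%:R.
Proof. by rewrite -polyC_natr; apply: (regularC ab); rewrite pnatr_eq0. Qed.

(** Splitting by half angles [n] times leaves linear factors [(1 + cos t) X + (1 - cos t)] with [t]
    still in the open interval. Both coefficients are positive there, so each factor is a positive
    multiple of some [a + s] with [s > 0]. *)
Lemma regular_shifted n t : 0 < t < pi -> regular a (shifted n (cos t)).
Proof.
elim: n t => [|n IH] t t0.
  rewrite shifted0; have [? ?] := cos_lt1 t0.
  by have [] := @regular_lin (1 + cos t) (1 - cos t).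
have [? ?] := half_range t0.
rewrite shifted_cosS; apply: (regularM ab); last exact: IH.
by apply: (regularM ab); [exact: regular_nat | exact: IH].
Qed.

Lemma pihalf_range : 0 < (pi : R) / 2 < (pi : R).
Proof. by have := pi_gt0 R; move=> p0; apply/andP; split; lra. Qed.

Lemma regular_nump n : regular a (nump n).
Proof.
case: n => [|n]; first exact: (regular_nat 0).
by rewrite -shiftedN0 -cos_pihalf; apply: regular_shifted; exact: pihalf_range.
Qed.

Lemma regular_denp n : regular a (denp n).
Proof.
elim: n => [|n IH]; first exact: (regular_nat 0).
rewrite denpS; apply: (regularM ab) => //.
by apply: (regularM ab); [exact: regular_nat | exact: regular_nump].
Qed.

Definition newton_op n := opfrac a (nump n) (denp n).
(* At [t = pi / 2] this is [a] times the inverse of [newton_op n.+1]. *)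
Definition coth_avg n t := opfrac a ('X * denp n.+1) (shifted n (cos t)).

Lemma half_polyC : (2^-1 : R[i])%:P * 2%:R = 1.
Proof. by rewrite -[X in _ * X](polyC_natr _ 2) -polyCM mulVf // pnatr_eq0. Qed.

(** Partial fractions: the two half-angle factors add up to [2 nump n.+1], exactly the factor that
    the denominator [denp] gains in one Newton step. *)
Lemma coth_avgS n t v : 0 < t < pi ->
  coth_avg n.+1 t v = 2^-1 *: (coth_avg n (t / 2) v + coth_avg n (pi - t / 2) v).
Proof.
move=> t0; have [t1 t2] := half_range t0.
have r1 := regular_shifted n t1; have r2 := regular_shifted n t2.
rewrite /coth_avg (opfracD ab) // (opfracZ ab).
congr (_ v); apply: (opfrac_eq ab); first exact: regular_shifted.
  exact: (regularM ab).
rewrite shifted_cosS denpS cos_piB.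
have := shifted_sum n (cos (t / 2)); have := half_polyC.
move: (shifted n (cos _)) (shifted n (- _)) (nump _) (denp _) (2^-1)%:P => S S' P Q h h2 SS.
have -> : 'X * Q * S' + 'X * Q * S = 'X * Q * (S + S') by ring.
rewrite SS; transitivity ((h * 2%:R) * (2%:R * 'X * P * Q * S * S')); last by ring.
by rewrite h2; ring.
Qed.

Lemma newton_op_bounded n : bounded_operator (newton_op n).
Proof. by apply: (bounded_opfrac ab); exact: regular_denp. Qed.

Lemma newton_op_inverse n : inverse_operator (newton_op n) (opfrac a (denp n) (nump n)).
Proof. exact: (opfrac_inverse ab (regular_nump n) (regular_denp n)). Qed.

Lemma opfrac_arg p q v : regular a q -> opfrac a p q (a v) = opfrac a (p * 'X) q v.
Proof.
move=> qr; have [u ->] := regular_surj v qr.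
rewrite [RHS]opfrac_op // -[a (op_poly q a u)]op_polyX (op_poly_comm ab) opfrac_op //.
by rewrite (op_polyM ab).
Qed.

Lemma newton_opS n v :
  newton_op n.+1 v = 2^-1 *: (newton_op n v + opfrac a (denp n) (nump n) (a v)).
Proof.
have rP := regular_nump n; have rQ := regular_denp n.
rewrite opfrac_arg // (opfracD ab) // (opfracZ ab).
congr (_ v); apply: (opfrac_eq ab).
- exact: regular_denp.
- exact: (regularM ab).
rewrite numpS denpS; have := half_polyC.
move: (nump n) (denp n) (2^-1)%:P => P Q h h2.
transitivity ((h * 2%:R) * ((P ^+ 2 + 'X * Q ^+ 2) * P * Q)); last by ring.
by rewrite h2; ring.
Qed.

Lemma newton_op0 : newton_op 0 = (fun v => v).
Proof.
apply/funext => v; have r1 : regular a (denp 0) by exact: regular_denp.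
by have := @opfrac_op _ _ a 1 1 v r1; rewrite !op_poly1.
Qed.

Lemma newton_opE n : newton a (fun v => v) n = newton_op n.
Proof.
elim: n => [|n IH]; first by rewrite newton_op0.
by apply/funext => v; rewrite /= IH (op_inv_unique (newton_op_inverse n)) newton_opS.
Qed.

(** Newton's step with [a X^-1] recognised as the average at [pi / 2]; it transfers convergence from
    the averages to the iterates. *)
Lemma newton_opSS n v :
  newton_op n.+2 v = 2^-1 *: (newton_op n.+1 v + coth_avg n (pi / 2) v).
Proof.
rewrite newton_opS opfrac_arg; last exact: regular_nump.
by rewrite /coth_avg cos_pihalf shiftedN0 mulrC.
Qed.

(** Both factors tend to the same operator [b], so in the limit this becomes [b^2 = a], whether or
    not [a] is invertible. *)
Lemma newton_op_coth n v : newton_op n.+1 (coth_avg n (pi / 2) v) = a v.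
Proof.
rewrite /coth_avg cos_pihalf shiftedN0 mulrC -opfrac_arg; last exact: regular_nump.
by case: (newton_op_inverse n.+1) => _ _ ->.
Qed.

End NewtonOperators.

(** * Convergence of the iterates *)

Section Trigonometry.
Context {R : realType}.
Implicit Types (s t x y : R).

Lemma sin_lipschitz x y : `|sin x - sin y| <= `|x - y|.
Proof.
wlog xy : x y / x <= y => [W|].
  by have [/W//|/ltW /W] := leP x y; rewrite distrC (distrC y).
move: xy; rewrite le_eqVlt => /orP[/eqP ->|xy]; first by rewrite !subrr.
have [z _ E] := @MVT R sin cos x y xy (fun z _ => is_derive_sin z)
  (continuous_subspaceT (@continuous_sin R)).
rewrite distrC E normrM (distrC x) ler_piMl // ler_norml cos_geN1 cos_le1 //.
Qed.

(** The singularity of the Lipschitz constant at small angles, plus a constant chosen so that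
    halving the angle costs a factor below 4. *)
Definition weight t := (sin (t / 2))^-1 + 4.

Lemma sin_half_gt0 t : 0 < t < pi -> 0 < sin (t / 2).
Proof. by move=> /andP[t0 t1]; apply: sin_gt0_pihalf; apply/andP; split; lra. Qed.

Lemma weight_gt0 t : 0 < t < pi -> 0 < weight t.
Proof. by move=> t0; rewrite addr_gt0 // invr_gt0 sin_half_gt0. Qed.

Lemma cos_sin_half t : cos t = 1 - 2 * sin (t / 2) ^+ 2.
Proof. by have := cos_half_sq t; rewrite cos2sin2 => h; lra. Qed.

(** With [s = sin(t/2)], the bounds [1 / sin(t/4) <= 2 / s] and [1 / cos(t/4) <= 2] make the left
    side at most [2 / s + 10], while the right side is [7 / (2 s) + 14]. Without the constant 4 in
    the weight these bounds would give only the factor 4, hence ratio 1 in the recursion. *)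
Lemma weight_half t : 0 < t < pi ->
  weight (t / 2) + weight (pi - t / 2) <= 7 / 2 * weight t.
Proof.
move=> t0; have [t1 t2] := half_range t0; rewrite /weight.
set s := sin (t / 2); set s1 := sin (t / 2 / 2).
have -> : sin ((pi - t / 2) / 2) = cos (t / 2 / 2).
  by rewrite -cosBpihalf -cosN; congr cos; lra.
set k := cos _; have s0 : 0 < s := sin_half_gt0 t0.
have s10 : 0 < s1 := sin_half_gt0 t1.
have sE : s = 2 * s1 * k.
  by rewrite /s {1}(splitr (t / 2)) sinD -/s1 -/k; ring.
have k0 : 0 < k.
  by have := s0; rewrite sE -mulrA !pmulr_rgt0.
have k1 : 1 / 2 <= k.
  have kE : 2 * k ^+ 2 = 1 + cos (t / 2) by exact: cos_half_sq.
  have c0 : 0 <= cos (t / 2).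
    by apply: cos_ge0_pihalf; have /andP[? ?] := t0; apply/andP; split; lra.
  rewrite -(ler_pXn2r (n := 2)) ?nnegrE //; lra.
have ss : s <= 2 * s1 by rewrite sE ler_piMr ?cos_le1 // mulr_ge0 // ltW.
have ks : s1^-1 <= 2 * s^-1.
  by rewrite -[s1^-1]mul1r ler_pdivrMr // mulrAC ler_pdivlMr // mul1r.
have kk : k^-1 <= 2 by rewrite -[k^-1]mul1r ler_pdivrMr //; lra.
have : 0 < s^-1 by rewrite invr_gt0.
lra.
Qed.

Lemma weight_pihalf : weight (pi / 2) <= 6.
Proof.
have [s0 _] := half_range (@pihalf_range R).
have sp : 0 < sin ((pi : R) / 2 / 2) := sin_half_gt0 (@pihalf_range R).
have := cos_sin_half (pi / 2 : R); rewrite cos_pihalf => h.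
suff : (sin (pi / 2 / 2 : R))^-1 <= 2 by rewrite /weight; lra.
rewrite -[_^-1]mul1r ler_pdivrMr //.
have : 1 / 2 <= sin ((pi : R) / 2 / 2); last by lra.
rewrite -(ler_pXn2r (n := 2)) ?nnegrE //; [lra|exact: ltW].
Qed.

(** The difference of cosines is one of squared sines, so it carries a sine as extra factor. That
    sine cancels one of the two in [1 - cos x = 2 sin(x/2)^2]. *)
Lemma cos_dist_bound x y : 0 < x < pi -> 0 < y < pi ->
  `|cos x - cos y| <= 2 * `|x - y| * Num.max (sin (x / 2)) (sin (y / 2)).
Proof.
move=> x0 y0; have sx := sin_half_gt0 x0; have sy := sin_half_gt0 y0.
have -> : cos x - cos y = - (2 * (sin (x / 2) - sin (y / 2)) * (sin (x / 2) + sin (y / 2))).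
  by rewrite (cos_sin_half x) (cos_sin_half y); ring.
rewrite normrN !normrM (ger0_norm (x := 2)) // (gtr0_norm (addr_gt0 sx sy)).
set m := Num.max _ _.
have sm : sin (x / 2) + sin (y / 2) <= 2 * m.
  by rewrite mulr_natl mulr2n; apply: lerD; rewrite le_max lexx ?orbT.
have sd : `|sin (x / 2) - sin (y / 2)| <= `|x - y| / 2.
  apply: le_trans (sin_lipschitz _ _) _; rewrite -mulrBl normrM.
  by rewrite (ger0_norm (x := 2^-1)).
apply: le_trans (ler_pM _ _ (lexx _) sm) _.
- by rewrite mulr_ge0.
- by rewrite ltW // addr_gt0.
rewrite mulrA; apply: ler_wpM2r; first by rewrite le_max (ltW sx).
lra.
Qed.

End Trigonometry.

Section Convergence.
Context {R : realType} {H : hilbertType R} (a : H -> H) (M c : R).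
Hypotheses (al : linear a) (M0 : 0 <= M) (aM : bnd a M) (c01 : 0 < c <= 1)
  (ac : lower_sect c a).
Implicit Types (u v : H) (s t : R).

Let ab : bounded_operator a := bnd_bounded_operator al aM.
Let c0 : 0 < c. Proof. by case/andP: c01. Qed.

Definition opfracX_bound : R := 1 + c^-1 + M / c.

Lemma opfracX_bound_gt0 : 0 < opfracX_bound.
Proof.
have : 0 < c^-1 by rewrite invr_gt0.
have : 0 <= M / c by rewrite divr_ge0 // ltW.
rewrite /opfracX_bound; lra.
Qed.

Lemma shifted0_inv_bound t : 0 < t < pi ->
  bnd (op_inv (op_poly (shifted 0 (cos t)) a)) (c * (1 - cos t))^-1.
Proof.
move=> t0; rewrite shifted0; have [? ?] := cos_lt1 t0.
by have [] := regular_lin al M0 aM c01 ac (t := 1 + cos t) (s := 1 - cos t).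
Qed.

Lemma opfracX_bnd t v : 0 < t < pi ->
  2 * nrm (opfrac a 'X (shifted 0 (cos t)) v) <= opfracX_bound * nrm v.
Proof.
move=> t0; have [_ d0] := cos_lt1 t0.
have := shifted0_inv_bound t0 v.
have [_ _ /(_ v)] := op_invP (regular_shifted al M0 aM c01 ac 0 t0).
rewrite /opfrac /= op_polyX shifted0; move: (op_inv _ _) => u.
rewrite op_polyD op_polyMX !op_polyC; set d := 1 - cos t in d0 * => uv ub.
have {}ub : d * nrm u <= c^-1 * nrm v.
  by move: ub; rewrite invfM -mulrA mulrCA -ler_pdivlMl ?invr_gt0 // invrK.
have -> : 2 * nrm (a u) = nrm ((2%:R : R)%:C%C *: a u).
  by rewrite nrmZR ger0_norm.
(* As [v = (1 + cos t) a u + d u], the vector [2 a u] is expressed by [v], [d u] and [d a u]. The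
   factor [d] compensates the growth of the resolvent, because [d |u| <= |v| / c]. *)
have -> : (2%:R : R)%:C%C *: a u = v - d%:C%C *: u + d%:C%C *: a u.
  rewrite -uv addrK -scalerDl -rmorphD /=; congr (_%:C%C *: _); rewrite /d; ring.
apply: le_trans (nrmD _ _) _; apply: le_trans (lerD (nrmD _ _) (lexx _)) _.
rewrite nrmN !nrmZR (gtr0_norm d0).
have aub : d * nrm (a u) <= M * (d * nrm u).
  by rewrite mulrCA ler_wpM2l ?aM // ltW.
have := ler_wpM2l M0 ub; rewrite /opfracX_bound; lra.
Qed.

Definition lip_const : R := (1 + M) * opfracX_bound / c.

Lemma lip_const_ge0 : 0 <= lip_const.
Proof.
by rewrite /lip_const divr_ge0 ?mulr_ge0 ?(ltW opfracX_bound_gt0) ?(ltW c0) // addr_ge0.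
Qed.

Lemma coth_avg0_bnd t : 0 < t < pi -> bnd (coth_avg a 0 t) opfracX_bound.
Proof.
move=> t0 v; have /= := opfracX_bnd v t0; congr (_ <= _).
rewrite -(ger0_norm (x := 2)) // -nrmZR /coth_avg denpS /nump /denp /= !mulr1.
by rewrite /opfrac /= mulrC -polyC_natr op_polyZ // rmorph_nat.
Qed.

(** The difference of the two fractions has numerator [2 (cos s - cos t) (1 - X) X]. The factor [X]
    is absorbed by the denominator at [s] through [opfracX_bnd], so only the resolvent at [t] costs
    a factor [1 / (c (1 - cos t))]. *)
Lemma coth_avg0_diff s t v : 0 < s < pi -> 0 < t < pi ->
  nrm (coth_avg a 0 s v - coth_avg a 0 t v) * (1 - cos t) <=
    lip_const * `|cos s - cos t| * nrm v.
Proof.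
move=> s0 t0; have rs := regular_shifted al M0 aM c01 ac 0 s0.
have rt := regular_shifted al M0 aM c01 ac 0 t0; have [_ d0] := cos_lt1 t0.
rewrite (opfracB ab) //.
set w := op_inv (op_poly (shifted 0 (cos t)) a) v.
have -> : opfrac a ('X * denp 1 * shifted 0 (cos t) - 'X * denp 1 * shifted 0 (cos s))
    (shifted 0 (cos s) * shifted 0 (cos t)) v =
  (2 * (cos s - cos t))%:C%C *: (opfrac a 'X (shifted 0 (cos s)) w
      - a (opfrac a 'X (shifted 0 (cos s)) w)).
  have -> : 'X * denp 1 * shifted 0 (cos t) - 'X * denp 1 * shifted 0 (cos s) =
      (2 * (cos s - cos t))%:C%C%:P * ((1 - 'X) * 'X) :> {poly R[i]}.
    rewrite /shifted denpS /nump /denp /= expn0 expr1 rmorphM rmorphB rmorph_nat.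
    by rewrite polyCM polyCB polyC_natr; ring.
  rewrite -(opfracZ ab); congr (_ *: _).
  have := opfracM ab ((1 - 'X) * 'X) 1 v rs rt; rewrite mulr1 => <-.
  have -> : opfrac a 1 (shifted 0 (cos t)) v = w by rewrite /opfrac /= op_poly1.
  rewrite /opfrac /= mulrDl mul1r op_polyD; congr (_ + _).
  by rewrite mulNr op_polyN op_polyMX !op_polyX.
set y := opfrac _ _ _ w; rewrite nrmZR.
have yb : nrm (y - a y) <= (1 + M) * nrm y.
  by apply: le_trans (nrmD _ _) _; rewrite nrmN mulrDl mul1r lerD2l.
have yw : 2 * nrm y <= opfracX_bound * nrm w by exact: opfracX_bnd.
have wb : nrm w * (1 - cos t) <= c^-1 * nrm v.
  apply: le_trans (ler_wpM2r (ltW d0) (shifted0_inv_bound t0 v)) _.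
  by rewrite mulrAC invfM -(mulrA c^-1) mulVf ?mulr1 // gt_eqF.
have K0 := opfracX_bound_gt0.
rewrite normrM (ger0_norm (x := 2)) // /lip_const.
set e := `|_ - _|; have e0 : 0 <= e by exact: normr_ge0.
have M1 : 0 <= 1 + M by rewrite addr_ge0.
have h1 : nrm (y - a y) * 2 <= (1 + M) * (opfracX_bound * nrm w).
  have := ler_wpM2l M1 yw; have := yb; lra.
have h2 : nrm (y - a y) * 2 * (1 - cos t) <= (1 + M) * (opfracX_bound * (c^-1 * nrm v)).
  apply: le_trans (ler_wpM2r (ltW d0) h1) _; rewrite -!mulrA.
  by rewrite !ler_wpM2l // ltW.
have := ler_wpM2l e0 h2; set z := nrm (y - a y).
by congr (_ <= _); ring.
Qed.

Lemma coth_avg0_lip s t : 0 < s < pi -> 0 < t < pi ->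
  bnd (coth_avg a 0 s \- coth_avg a 0 t) (lip_const * weight s * `|s - t|).
Proof.
move=> s0 t0 v /=; set d := nrm _.
have d0 : 0 <= d by exact: nrm_ge0.
have L0 := lip_const_ge0.
have hs := sin_half_gt0 s0; have ht := sin_half_gt0 t0.
have dt := coth_avg0_diff v s0 t0; have ds := coth_avg0_diff v t0 s0.
rewrite nrmBC -/d distrC in ds; rewrite -/d in dt.
have dcos := cos_dist_bound s0 t0.
have E x : 1 - cos x = 2 * sin (x / 2) ^+ 2 by rewrite (cos_sin_half x); ring.
rewrite !E in ds dt.
set S := sin (s / 2) in hs dcos ds; set T := sin (t / 2) in ht dcos dt.
set e := `|cos s - cos t| in dcos ds dt; set f := `|s - t| in dcos *.
have f0 : 0 <= f by exact: normr_ge0.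
set m := Num.max S T in dcos.
have Sm : S <= m by rewrite le_max lexx.
have m0 : 0 < m by exact: lt_le_trans Sm.
(* By symmetry the larger of the two sines may stand on the left. One power of [m] then cancels
   against the cosine bound, and [S <= m] leaves a weight that depends on [s] alone. *)
have dm : d * (2 * m ^+ 2) <= lip_const * e * nrm v.
  by rewrite /m; case: (leP S T).
have : d * (2 * m ^+ 2) <= lip_const * (2 * f * m) * nrm v.
  by apply: le_trans dm _; apply: ler_wpM2r; [exact: nrm_ge0|exact: ler_wpM2l].
have -> : d * (2 * m ^+ 2) = (2 * m) * (d * m) by ring.
have -> : lip_const * (2 * f * m) * nrm v = (2 * m) * (lip_const * f * nrm v) by ring.
rewrite ler_pM2l; last by rewrite mulr_gt0.
move=> dm'.
have dS : d * S <= lip_const * f * nrm v.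
  by apply: le_trans dm'; exact: ler_wpM2l.
rewrite /weight -/S; apply: (@le_trans _ _ (lip_const * f * nrm v * S^-1)).
  by rewrite ler_pdivlMr.
have : 0 <= lip_const * f * nrm v by exact: mulr_ge0 (mulr_ge0 L0 f0) (nrm_ge0 v).
move: S^-1 => si; set k := lip_const * f * nrm v => k0.
have -> : lip_const * (si + 4) * f * nrm v = k * si + 4 * k by rewrite /k; ring.
lra.
Qed.

Lemma coth_avg_lip n s t : 0 < s < pi -> 0 < t < pi ->
  bnd (coth_avg a n s \- coth_avg a n t)
    (lip_const * (7 / 8) ^+ n * weight s * `|s - t|).
Proof.
have L0 := lip_const_ge0.
elim: n s t => [|n IH] s t s0 t0 v.
  by rewrite expr0 mulr1; exact: coth_avg0_lip.
have [s1 s2] := half_range s0; have [t1 t2] := half_range t0.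
rewrite /= !(coth_avgS al M0 aM c01 ac) // -scalerBr opprD addrACA.
apply: nrm_half_sum (IH _ _ s1 t1 v) (IH _ _ s2 t2 v) _.
have -> : `|s / 2 - t / 2| = `|s - t| / 2.
  by rewrite -mulrBl normrM (ger0_norm (x := 2^-1)) // invr_ge0.
have -> : `|pi - s / 2 - (pi - t / 2)| = `|s - t| / 2.
  rewrite (_ : _ - _ = - ((s - t) / 2)); last by ring.
  by rewrite normrN normrM (ger0_norm (x := 2^-1)) // invr_ge0.
have x0 : 0 <= lip_const * (7 / 8) ^+ n * `|s - t| * nrm v.
  apply: mulr_ge0 (nrm_ge0 v); apply: mulr_ge0; last exact: normr_ge0.
  by apply: mulr_ge0 => //; rewrite exprn_ge0 // divr_ge0.
have := ler_wpM2l x0 (weight_half s0); rewrite exprS {IH x0}.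
move: lip_const ((7 / 8) ^+ n) `|s - t| (nrm v) => l k d y.
move: (weight s) (weight (s / 2)) (weight (pi - s / 2)) => w0 w1 w2; lra.
Qed.

End Convergence.

(** * The limit of the iterates and its square *)

Section Limit.
Context {R : realType} {H : hilbertType R} (a : H -> H) (M c : R).
Hypotheses (al : linear a) (M0 : 0 <= M) (aM : bnd a M) (c01 : 0 < c <= 1)
  (ac : lower_sect c a).
Implicit Types (u v : H) (f b : H -> H).

Let ab : bounded_operator a := bnd_bounded_operator al aM.
Let k01 : 0 <= (7 / 8 : R) < 1. Proof. by apply/andP; split; lra. Qed.
Let kn0 n : 0 <= (7 / 8 : R) ^+ n. Proof. by rewrite exprn_ge0 //; lra. Qed.

(** The factor 6 bounds [weight (pi / 2)], and [pi] bounds the distance of an angle from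
    [pi / 2]. *)
Definition coth_const : R := lip_const M c * 6 * pi.
(** The first error needs [1 + M], [opfracX_bound] and [8 * coth_const], where 8 is [1 / (1 - 7/8)].
    The recursion halves the error and feeds in half of [8 * coth_const]; it closes at ratio 7/8
    once the coefficient of [coth_const] is at least 32/3, so 40 leaves room. *)
Definition newton_const : R := 1 + M + opfracX_bound M c + 40 * coth_const.

Lemma coth_const_ge0 : 0 <= coth_const.
Proof. by apply: mulr_ge0 (pi_ge0 R); apply: mulr_ge0 => //; exact: lip_const_ge0. Qed.

Lemma newton_const_ge0 : 0 <= newton_const.
Proof.
have := coth_const_ge0; have := opfracX_bound_gt0 M0 c01; have := M0; rewrite /newton_const; lra.
Qed.

Lemma nrm_le0 v (C : R) : 0 <= C -> (forall n, nrm v <= C * (7 / 8) ^+ n) -> v = 0.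
Proof.
move=> C0 vC; apply/nrm_eq0/le_anti; rewrite nrm_ge0 andbT.
exact: le0_geo k01 C0 vC.
Qed.

Lemma halfD v : 2^-1 *: (v + v) = v.
Proof. by rewrite scalerDr -scalerDl -[2^-1]mul1r -splitr scale1r. Qed.

(** One averaging step replaces the value at [pi / 2] by the mean of the values at [pi / 4] and
    [3 pi / 4], so the change is controlled by the Lipschitz constant of the [n]-th average. *)
Lemma coth_avg_step n : bnd (coth_avg a n.+1 (pi / 2) \- coth_avg a n (pi / 2))
  (coth_const * (7 / 8) ^+ n).
Proof.
move=> v; have p0 := @pihalf_range R; have [p1 p2] := half_range p0.
rewrite /= (coth_avgS al M0 aM c01 ac) //.
set x := coth_avg a n (pi / 2) v.
have -> : forall y z : H, 2^-1 *: (y + z) - x = 2^-1 *: ((y - x) + (z - x)).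
  by move=> y z; rewrite -{1}(halfD x) -scalerBr opprD addrACA.
have L t : 0 < t < pi -> `|pi / 2 - t| <= pi ->
    nrm (coth_avg a n t v - x) <= coth_const * (7 / 8) ^+ n * nrm v.
  move=> t0 tp; rewrite nrmBC; apply: le_trans (coth_avg_lip al M0 aM c01 ac n p0 t0 v) _.
  apply: ler_wpM2r; first exact: nrm_ge0.
  have wd : weight (pi / 2) * `|pi / 2 - t| <= 6 * pi.
    by apply: ler_pM => //; [exact/ltW/weight_gt0|exact: weight_pihalf].
  have := lip_const_ge0 M0 c01; rewrite /coth_const; move: (lip_const M c) => L L0.
  have := ler_wpM2l (mulr_ge0 L0 (kn0 n)) wd; set k := (7 / 8) ^+ n.
  by congr (_ <= _); ring.
have pi0 := pi_gt0 R.
have h1 : nrm (coth_avg a n (pi / 2 / 2) v - x) <= coth_const * (7 / 8) ^+ n * nrm v.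
  by apply: L => //; rewrite ger0_norm; lra.
have h2 : nrm (coth_avg a n (pi - pi / 2 / 2) v - x) <= coth_const * (7 / 8) ^+ n * nrm v.
  by apply: L => //; rewrite ler0_norm; lra.
apply: nrm_half_sum h1 h2 _.
by move: (coth_const * (7 / 8) ^+ n * nrm v) => y; lra.
Qed.

Lemma linear_limit (F : nat -> H -> H) b (C : R) : 0 <= C ->
  (forall n, linear (F n)) -> (forall n, bnd (F n \- b) (C * (7 / 8) ^+ n)) ->
  linear b.
Proof.
move=> C0 Fl Fb l u v; apply/eqP; rewrite -subr_eq0; apply/eqP.
pose S := nrm (l *: u + v) + cnrm l * nrm u + nrm v.
apply: (@nrm_le0 _ (C * S)) => [|n].
  by rewrite mulr_ge0 // !addr_ge0 ?mulr_ge0 ?nrm_ge0 ?cnrm_ge0.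
apply: le_trans (nrmB _ (F n (l *: u + v)) _) _; rewrite nrmBC.
rewrite [X in nrm (X - (l *: b u + b v))]Fl opprD addrACA -scalerBr.
apply: le_trans (lerD (Fb n _) (nrmD _ _)) _; rewrite nrmZ.
have h1 := ler_wpM2l (cnrm_ge0 l) (Fb n u); have h2 := Fb n v; rewrite /= in h1 h2.
rewrite /S; move: h1 h2; set k := (7 / 8) ^+ n; lra.
Qed.

Lemma coth_limit : exists2 b, linear b &
  forall n, bnd (coth_avg a n (pi / 2) \- b) (8 * coth_const * (7 / 8) ^+ n).
Proof.
have [b bl] : exists b, forall n, bnd (coth_avg a n (pi / 2) \- b) (8 * coth_const * (7 / 8) ^+ n).
  suff /choice[b bP] : forall v, exists w, forall n,
      nrm (coth_avg a n (pi / 2) v - w) <= 8 * coth_const * (7 / 8) ^+ n * nrm v.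
    by exists b => n v; exact: bP.
  move=> v; have [||w wP] := @geo_cvg _ _ (fun n => coth_avg a n (pi / 2) v)
      (coth_const * nrm v) (7 / 8) k01.
  - exact: mulr_ge0 coth_const_ge0 (nrm_ge0 v).
  - by move=> n; have := coth_avg_step n v; rewrite /= mulrAC.
  exists w => n; apply: le_trans (wP n) _.
  have -> : (1 - 7 / 8 : R) = 8^-1 by lra.
  rewrite invrK le_eqVlt; apply/orP; left; apply/eqP.
  by move: coth_const ((7 / 8) ^+ n) => C k; ring.
exists b => //; apply: (@linear_limit (fun n => coth_avg a n (pi / 2)) b (8 * coth_const)) => //.
  by apply: mulr_ge0 coth_const_ge0.
move=> n; have p0 := @pihalf_range R.
by have [] := bounded_opfrac ab ('X * denp n.+1) (regular_shifted al M0 aM c01 ac n p0).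
Qed.

Lemma newton_op_limit b :
  (forall n, bnd (coth_avg a n (pi / 2) \- b) (8 * coth_const * (7 / 8) ^+ n)) ->
  forall n, bnd (newton_op a n.+1 \- b) (newton_const * (7 / 8) ^+ n).
Proof.
move=> bl; have C0 := coth_const_ge0; have K0 := opfracX_bound_gt0 M0 c01.
elim=> [|n IH] v /=.
  rewrite (newton_opS al M0 aM c01 ac) (newton_op0 al M0 aM c01 ac).
  have -> : opfrac a (denp 0) (nump 0) (a v) = a v.
    have r1 : regular a (nump 0) by exact: (regular_nump al M0 aM c01 ac).
    by have := @opfrac_op _ _ a 1 1 (a v) r1; rewrite !op_poly1.
  have p0 := @pihalf_range R.
  have h1 := bl 0 v; have h2 := coth_avg0_bnd al M0 aM c01 ac p0 v.
  rewrite /= expr0 !mulr1 in h1 h2 *.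
  apply: le_trans (nrmB _ 0 _) _; rewrite subr0 sub0r nrmN nrm_half.
  have h3 := nrmB (b v) (coth_avg a 0 (pi / 2) v) 0.
  rewrite !subr0 (nrmBC (b v)) in h3.
  have h4 := nrmD v (a v); have h5 := aM v; have v0 := nrm_ge0 v.
  have h6 := mulr_ge0 M0 v0; have h7 := mulr_ge0 C0 v0; rewrite /newton_const; lra.
rewrite (newton_opSS al M0 aM c01 ac) -{1}(halfD (b v)) -scalerBr opprD addrACA nrm_half.
have h1 := bl n v; have h2 := IH v; rewrite /= in h1 h2.
have := nrmD (newton_op a n.+1 v - b v) (coth_avg a n (pi / 2) v - b v).
rewrite exprS; set k := (7 / 8) ^+ n in h1 h2 *.
have v0 : 0 <= k * nrm v by rewrite mulr_ge0 ?nrm_ge0 ?kn0.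
have h6 := mulr_ge0 M0 v0; have h7 := mulr_ge0 C0 v0; have h8 := mulr_ge0 (ltW K0) v0.
move: h1 h2; rewrite /newton_const; lra.
Qed.

Lemma newton_limit : exists b, [/\ linear b,
  forall n, bnd (newton_op a n.+1 \- b) (newton_const * (7 / 8) ^+ n) &
  forall n, bnd (coth_avg a n (pi / 2) \- b) (newton_const * (7 / 8) ^+ n)].
Proof.
have [b bl bP] := coth_limit; exists b; split=> // n; first exact: newton_op_limit.
apply: bnd_le (bP n) _; apply: ler_wpM2r; first exact: kn0.
have := coth_const_ge0; have := opfracX_bound_gt0 M0 c01; have := M0; rewrite /newton_const; lra.
Qed.

Section LimitProperties.
Context b (bl : linear b)
  (bX : forall n, bnd (newton_op a n.+1 \- b) (newton_const * (7 / 8) ^+ n))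
  (bZ : forall n, bnd (coth_avg a n (pi / 2) \- b) (newton_const * (7 / 8) ^+ n)).

Lemma bounded_limit : bounded_operator b.
Proof.
have [N N0 XN] := bounded_operator_bnd (newton_op_bounded al M0 aM c01 ac 1).
apply: (bnd_bounded_operator (M := N + newton_const)) => // v.
have := nrmB (b v) (newton_op a 1 v) 0; rewrite !subr0 nrmBC.
have := bX 0 v; have := XN v; rewrite /= expr0 mulr1; lra.
Qed.

Lemma limit_sqr v : b (b v) = a v.
Proof.
have [N N0 bN] := bounded_operator_bnd bounded_limit.
apply/eqP; rewrite -subr_eq0; apply/eqP; have C0 := newton_const_ge0.
apply: (@nrm_le0 _ (newton_const * (N * nrm v + newton_const * nrm v) + N * newton_const * nrm v)) => [|n].
  have v0 := nrm_ge0 v; apply: addr_ge0; last exact: mulr_ge0 (mulr_ge0 N0 C0) v0.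
  exact: mulr_ge0 C0 (addr_ge0 (mulr_ge0 N0 v0) (mulr_ge0 C0 v0)).
have <- := newton_op_coth al M0 aM c01 ac n v; set z := coth_avg a n (pi / 2) v.
apply: le_trans (nrmB _ (b z) _) _; rewrite -(linB bl).
have zb : nrm (z - b v) <= newton_const * (7 / 8) ^+ n * nrm v by exact: bZ.
have h1 : nrm (b (b v - z)) <= N * (newton_const * (7 / 8) ^+ n * nrm v).
  by apply: le_trans (bN _) _; rewrite nrmBC ler_wpM2l.
have h2 : nrm (b z - newton_op a n.+1 z) <= newton_const * (7 / 8) ^+ n * nrm z.
  by rewrite nrmBC; exact: bX.
have h3 : nrm z <= N * nrm v + newton_const * nrm v.
  have := nrmB z (b v) 0; rewrite !subr0; have := bN v.
  suff : newton_const * (7 / 8) ^+ n * nrm v <= newton_const * nrm v by lra.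
  rewrite ler_wpM2r ?nrm_ge0 // ler_piMr // exprn_ile1 //; lra.
have := ler_wpM2l (mulr_ge0 C0 (kn0 n)) h3.
set k := (7 / 8) ^+ n in h1 h2 *; lra.
Qed.

(** Serves uniqueness: any square root of [a] commutes with [a], hence with the limit [b]. *)
Lemma limit_commute f : bounded_operator f -> (forall v, f (a v) = a (f v)) ->
  forall v, f (b v) = b (f v).
Proof.
move=> fb fa v; have [N N0 fN] := bounded_operator_bnd fb; have C0 := newton_const_ge0.
apply/eqP; rewrite -subr_eq0; apply/eqP.
apply: (@nrm_le0 _ (N * (newton_const * nrm v) + newton_const * (N * nrm v))) => [|n].
  have v0 := nrm_ge0 v.
  exact: addr_ge0 (mulr_ge0 N0 (mulr_ge0 C0 v0)) (mulr_ge0 C0 (mulr_ge0 N0 v0)).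
apply: le_trans (nrmB _ (f (newton_op a n.+1 v)) _) _; rewrite -(linB fb.1) mulrDl.
have -> : f (newton_op a n.+1 v) = newton_op a n.+1 (f v).
  exact: (opfrac_commute _ _ fb.1 fa (regular_denp al M0 aM c01 ac _)).
apply: lerD.
  apply: le_trans (fN _) _; rewrite -mulrA ler_wpM2l // nrmBC mulrAC; exact: bX.
apply: le_trans (bX _ _) _; rewrite mulrAC ler_wpM2r ?kn0 // ler_wpM2l //; exact: fN.
Qed.

End LimitProperties.

End Limit.

(** * Accretivity of the limit *)

Section Sectors.
Context {R : realType} {H : hilbertType R}.
Implicit Types (u v w : H) (a b : H -> H).

Lemma sector_cos (th : R) z : 0 <= th <= pi -> sector th z ->
  cos th * cnrm z <= complex.Re z.
Proof.
move=> th0 [->|[r [t [r0 tth ->]]]]; first by rewrite /cnrm normr0 mulr0.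
have -> : cnrm (r * cos t +i* (r * sin t))%C = r.
  apply: (@pexpIrn _ 2) => //; rewrite ?nnegrE ?cnrm_ge0 ?ltW //.
  by rewrite cnrmE /= !exprMn -mulrDr cos2Dsin2 mulr1.
rewrite mulrC ler_pM2l // -(cos_norm t).
have /andP[th1 th2] := th0; move: tth; rewrite le_eqVlt => /orP[/eqP -> //|tth].
by rewrite ltW // ltr_cos ?in_itv /= ?th1 ?normr_ge0 // (le_trans (ltW tth)).
Qed.

Lemma numrange_inner a v : linear a -> nrm v != 0 ->
  numrange a ((nrm v ^- 2)%:C%C * inner (a v) v).
Proof.
move=> al v0; have vp : 0 < nrm v by rewrite lt_def v0 nrm_ge0.
apply: subset_closure; exists ((nrm v)^-1%:C%C *: v) => /=.
  by rewrite normE nrmZR gtr0_norm ?invr_gt0 // mulVf.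
rewrite (linZ al) innZl innZr mulrA; congr (_ * _).
by rewrite -exprVn expr2 rmorphM /= oppr0.
Qed.

Lemma numrange_ge a (k : R) : linear a ->
  (forall z, numrange a z -> k * cnrm z <= complex.Re z) ->
  forall v, k * cnrm (inner (a v) v) <= complex.Re (inner (a v) v).
Proof.
move=> al ak v; have [v0|v0] := eqVneq (nrm v) 0.
  by rewrite (nrm_eq0 v0) (lin0 al) linear0r /cnrm normr0 mulr0.
have := ak _ (numrange_inner al v0); rewrite ReR cnrmM cnrmR.
have vp : 0 < nrm v ^- 2 by rewrite invr_gt0 exprn_gt0 // lt_def v0 nrm_ge0.
by rewrite (gtr0_norm vp) mulrCA ler_pM2l.
Qed.

Lemma numrange_closed a z (e : R) : numrange a z -> 0 < e ->
  exists2 v, nrm v = 1 & cnrm (z - inner (a v) v) < e.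
Proof.
move=> az e0; have [] := az (ball (z : R[i]^o) e%:C%C).
  by apply: nbhsx_ballx; rewrite -[0]/(0%:C%C) ltcR.
move=> _ [[v /= v1 <-]]; rewrite -ball_normE /= cnormE ltcR => h.
by exists v => //; apply: complexI; rewrite -normE.
Qed.

Lemma Re_le_cnrm (z : R[i]) : `|complex.Re z| <= cnrm z.
Proof.
rewrite -(ler_pXn2r (n := 2)) ?nnegrE ?cnrm_ge0 //.
by rewrite real_normK ?num_real // cnrmE lerDl sqr_ge0.
Qed.

Lemma ReB (x y : R[i]) : complex.Re (x - y) = complex.Re x - complex.Re y.
Proof. by case: x y => ? ? []. Qed.

Lemma accretive_of_ip a : (forall v, 0 <= ip (a v) v) -> accretive a.
Proof.
move=> a0 z az /=; apply/ler_addgt0Pr => e e0.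
have [v _ h] := numrange_closed az e0.
have := Re_le_cnrm (z - inner (a v) v); rewrite ReB.
by have := a0 v; rewrite /ip ler_norml => h1 /andP[h2 _]; lra.
Qed.

(** For unit vectors, the values of the form keep distance at least [c s] from [- s]. The exclusion
    of negative values is what the gap estimate and the uniqueness of accretive roots rest on. *)
Definition sect (c : R) a := forall v s, 0 <= s ->
  c * s * nrm v ^+ 2 <= cnrm (inner (a v) v + (s * nrm v ^+ 2)%:C%C).

Lemma sect_lower c a : 0 <= c -> sect c a -> lower_sect c a.
Proof.
move=> c0 ac s v s0; have [v0|v0] := eqVneq (nrm v) 0.
  by rewrite v0 mulr0 nrm_ge0.
have vp : 0 < nrm v by rewrite lt_def v0 nrm_ge0.
rewrite -(ler_pM2r vp) -(mulrA (c * s)) -expr2; apply: le_trans (ac v s s0) _.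
have -> : inner (a v) v + (s * nrm v ^+ 2)%:C%C = inner (a v + s%:C%C *: v) v.
  by rewrite innDl innZl inn_norm rmorphM.
exact: inner_bound.
Qed.

(** With [q = |z|] and [Re z >= l q], [|z + r|^2] is at least [(q + r l)^2 + (1 - l^2) r^2], and
    [1 - l^2 >= (1 + l)^2] for [-1 < l <= 0]. *)
Lemma sect_of_cos (k : R) a : -1 < k ->
  (forall v, k * cnrm (inner (a v) v) <= complex.Re (inner (a v) v)) ->
  sect (1 + Num.min k 0) a.
Proof.
move=> k1 ak v s s0; have := ak v; set z := inner (a v) v => zk.
set l := Num.min k 0.
have l0 : l <= 0 by rewrite ge_min lexx orbT.
have l1 : -1 < l by rewrite lt_min k1 ltrN10.
have {}zk : l * cnrm z <= complex.Re z.
  by apply: le_trans zk; rewrite ler_wpM2r ?cnrm_ge0 // ge_min lexx.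
rewrite -mulrA; set r := s * nrm v ^+ 2.
have r0 : 0 <= r by rewrite mulr_ge0 ?sqr_ge0.
clearbody l r.
rewrite -(ler_pXn2r (n := 2)) ?nnegrE ?cnrm_ge0 //; last first.
  by rewrite mulr_ge0 //; lra.
rewrite cnrmE ReD ImD /= addr0.
have zE := cnrmE z; have := ler_wpM2l r0 zk.
have : 0 <= (cnrm z + r * l) ^+ 2 - 2 * r ^+ 2 * l * (1 + l).
  have := sqr_ge0 (cnrm z + r * l).
  have l2 : 0 <= (1 + l) * (- l) by apply: mulr_ge0; lra.
  have := mulr_ge0 (sqr_ge0 r) l2; lra.
move: zE; move: (cnrm z) (complex.Re z) (complex.Im z) => q x y E.
nra.
Qed.

Definition path_op (t : R) a v : H := (1 - t)%:C%C *: v + t%:C%C *: a v.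

(** For [t > 0], [path_op t a + s] is [t (a + r / t)] with [r = 1 - t + s]. So [c] is uniform along
    the segment, and for [t < 1] the form stays away from the whole half-line of nonpositive
    numbers, 0 included. *)
Lemma sect_path c a (t s : R) v : c <= 1 -> sect c a -> 0 <= t <= 1 -> 0 <= s ->
  c * (1 - t + s) * nrm v ^+ 2 <=
    cnrm (inner (path_op t a v) v + (s * nrm v ^+ 2)%:C%C).
Proof.
move=> c1 ac /andP[t0 t1] s0; rewrite /path_op innDl !innZl inn_norm.
set N := nrm v ^+ 2; have N0 : 0 <= N by exact: sqr_ge0.
set r := 1 - t + s; set z := inner (a v) v.
have -> : (1 - t)%:C%C * N%:C%C + t%:C%C * z + (s * N)%:C%C = t%:C%C * z + (r * N)%:C%C.
  by rewrite /r !rmorphM !rmorphD; ring.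
have r0 : 0 <= r by rewrite /r; lra.
have {}ac : forall x, 0 <= x -> c * x * N <= cnrm (z + (x * N)%:C%C) by move=> x; exact: ac.
clearbody r N z.
move: t0; rewrite le_eqVlt => /orP[/eqP <-|tp].
  by rewrite mul0r add0r cnrmR ger0_norm; [rewrite ler_wpM2r // ler_piMl|exact: mulr_ge0].
have := ac (r / t) (divr_ge0 r0 (ltW tp)); rewrite -(ler_pM2l tp).
have -> : t * (c * (r / t) * N) = c * r * N by field; rewrite gt_eqF.
move=> /le_trans; apply; rewrite -{1}(gtr0_norm tp) -cnrmR -cnrmM mulrDr.
rewrite -[t%:C%C * _%:C%C]rmorphM /= -/z; have -> // : t * (r / t * N) = r * N by field; rewrite gt_eqF.
Qed.

Lemma quad_disc (p q r : R) : 0 <= p -> (forall x, 0 <= p * x ^+ 2 + q * x + r) ->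
  q ^+ 2 <= 4 * p * r.
Proof.
rewrite le_eqVlt => /orP[/eqP <-|p0] h.
  rewrite mulr0 mul0r; have [->|q0] := eqVneq q 0; first by rewrite expr0n.
  (* If [p = 0] and [q] is nonzero, the affine function takes the value -1 at this point. *)
  have := h (- (r + 1) / q); rewrite mul0r add0r mulrCA mulfV // mulr1; lra.
have := h (- q / (2 * p)).
have -> : p * (- q / (2 * p)) ^+ 2 + q * (- q / (2 * p)) + r =
    (4 * p * r - q ^+ 2) / (4 * p) by field; rewrite gt_eqF.
by rewrite pmulr_lge0 ?invr_gt0 ?mulr_gt0 // subr_ge0.
Qed.

Lemma ip_quad b v w : linear b -> (forall u, 0 <= ip (b u) u) ->
  (ip (b v) w + ip (b w) v) ^+ 2 <= 4 * ip (b v) v * ip (b w) w.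
Proof.
move=> bl b0; apply: quad_disc => // x.
have := b0 (x%:C%C *: v + w); rewrite (linD bl) (linZ bl) !ipDl !ipDr !ipZl !ipZr.
by congr (_ <= _); ring.
Qed.

(* Cauchy-Schwarz for the form [ip (b v) w + ip (b w) v], tested on [w = b v] and
   [w = i b v], shows that [inner (a v) v] is close to [- |b v|^2] as soon as
   [ip (b v) v] is small. *)
Lemma accretive_sqrt_gap a b (N d : R) : linear b -> 0 <= N -> bnd b N ->
  (forall v, b (b v) = a v) -> (forall v, 0 <= ip (b v) v) -> 0 < d ->
  (forall v s, 0 <= s ->
    d * nrm v ^+ 2 <= cnrm (inner (a v) v + (s * nrm v ^+ 2)%:C%C)) ->
  exists2 e, 0 < e & forall v, e * nrm v ^+ 2 <= ip (b v) v.
Proof.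
move=> bl N0 bN ba b0 d0 ad.
have K0 : 0 < 8 * N ^+ 3 + 1 by rewrite ltr_wpDl // mulr_ge0 ?exprn_ge0.
(* Each of the two test vectors contributes [4 q N^3 |v|^2]; the added 1 keeps the denominator
   positive when [N = 0]. *)
exists (d ^+ 2 / (8 * N ^+ 3 + 1)) => [|v]; first by rewrite divr_gt0 // exprn_gt0.
have [v0|v0] := eqVneq (nrm v) 0; first by rewrite v0 expr0n mulr0.
have vp : 0 < nrm v ^+ 2 by rewrite exprn_gt0 // lt_def v0 nrm_ge0.
set q := ip (b v) v; have q0 : 0 <= q by exact: b0.
set z := inner (a v) v; set s := nrm (b v) ^+ 2.
have sv : 0 <= s / nrm v ^+ 2 by rewrite divr_ge0 ?sqr_ge0 // ltW.
have := ad v _ sv; rewrite divfK ?gt_eqF // -/z => dz.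
have Q w : nrm w = nrm (b v) -> ip (b w) w <= N ^+ 3 * nrm v ^+ 2.
  move=> wv; apply: le_trans (ler_norm _) _; apply: le_trans (ip_bound _ _) _.
  have := bN w; rewrite wv => h; have h2 := bN v.
  have b1 := nrm_ge0 (b v).
  apply: le_trans (ler_wpM2r b1 h) _; rewrite -mulrA -expr2.
  rewrite (exprS N) -mulrA; apply: ler_wpM2l => //.
  by rewrite -exprMn ler_pXn2r // nnegrE mulr_ge0 // nrm_ge0.
have hR := @ip_quad b v (b v) bl b0.
have hI := @ip_quad b v ('i%C *: b v) bl b0.
rewrite ip_norm ba -/q -/s in hR.
rewrite ipir inn_norm add0r (linZ bl) ba ipil -/q in hI.
have := Q (b v) erefl; rewrite ba => QR.
have QI : ip (b ('i%C *: b v)) ('i%C *: b v) <= N ^+ 3 * nrm v ^+ 2.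
  by apply: Q; rewrite nrmZ (_ : cnrm _ = 1) ?mul1r // /cnrm normc_def /= expr0n add0r expr1n sqrtr1.
rewrite (linZ bl) ba in QI; rewrite -/z in hI.
have {}hR : (s + complex.Re z) ^+ 2 <= 4 * q * ip (a v) (b v) by exact: hR.
have E : cnrm (z + s%:C%C) ^+ 2 = (s + complex.Re z) ^+ 2 + (- complex.Im z) ^+ 2.
  by rewrite cnrmE ReD ImD /= addr0 sqrrN addrC [s + _]addrC addrC.
have dz2 : (d * nrm v ^+ 2) ^+ 2 <= cnrm (z + s%:C%C) ^+ 2.
  by rewrite ler_pXn2r // nnegrE ?cnrm_ge0 // mulr_ge0 // ltW.
have t1 := ler_wpM2l (mulr_ge0 (ler0n _ 4) q0) QR.
have t2 := ler_wpM2l (mulr_ge0 (ler0n _ 4) q0) QI.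
rewrite mulrAC ler_pdivrMr // -(ler_pM2r vp).
set V := nrm v ^+ 2 in vp t1 t2 dz2 *.
have : 0 <= q * V by rewrite mulr_ge0 // ltW.
move: hR hI t1 t2 dz2; rewrite E; lra.
Qed.

End Sectors.

(** * Dependence of the averages on the operator *)

Section Perturbation.
Context {R : realType} {H : hilbertType R} (a1 a2 : H -> H) (M1 M2 c ep : R).
Hypotheses (al1 : linear a1) (M10 : 0 <= M1) (aM1 : bnd a1 M1)
  (ac1 : lower_sect c a1) (al2 : linear a2) (M20 : 0 <= M2) (aM2 : bnd a2 M2)
  (ac2 : lower_sect c a2) (c01 : 0 < c <= 1)
  (ep0 : 0 <= ep) (aep : bnd (a1 \- a2) ep).

Let ab1 : bounded_operator a1 := bnd_bounded_operator al1 aM1.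
Let ab2 : bounded_operator a2 := bnd_bounded_operator al2 aM2.
Let c0 : 0 < c. Proof. by case/andP: c01. Qed.

(** Resolvent identity in the form [a1 u1 - a2 u2 = d R2 (a1 - a2) u1] with [d = 1 - cos t], the
    coefficient [1 + cos t] having cancelled. The operator [R2] and the vector [u1] each cost a
    factor [1 / (c d)]. *)
Lemma coth_avg0_perturb t : 0 < t < pi ->
  bnd (coth_avg a1 0 t \- coth_avg a2 0 t) (2 / (c ^+ 2 * (1 - cos t)) * ep).
Proof.
move=> t0 v; have [s0 d0] := cos_lt1 t0.
have E (a : H -> H) w : bounded_operator a -> opfrac a ('X * denp 1) (shifted 0 (cos t)) w
    = (2%:R)%:C%C *: a (op_inv (op_poly (shifted 0 (cos t)) a) w).
  move=> ab; rewrite /opfrac /= denpS /nump /denp /= !mulr1 mulrC -polyC_natr.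
  by rewrite op_polyZ // op_polyX rmorph_nat.
rewrite /= /coth_avg !E // -scalerBr nrmZR ger0_norm //.
have /= u1b := shifted0_inv_bound al1 M10 aM1 c01 ac1 t0 v.
have u2b := shifted0_inv_bound al2 M20 aM2 c01 ac2 t0.
have [_ _ /(_ v)] := op_invP (regular_shifted al1 M10 aM1 c01 ac1 0 t0).
have [R2b R2K R2V] := op_invP (regular_shifted al2 M20 aM2 c01 ac2 0 t0).
have {R2V} := R2V v; move: (op_inv (op_poly (shifted 0 (cos t)) a2)) R2b u2b R2K => R2 R2b u2b R2K.
move: (op_inv (op_poly (shifted 0 (cos t)) a1) v) u1b => u1 u1b.
set u2 := R2 v.
have TE (a : H -> H) w : op_poly (shifted 0 (cos t)) a w =
    (1 + cos t)%:C%C *: a w + (1 - cos t)%:C%C *: w.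
  by rewrite shifted0 op_polyD op_polyMX !op_polyC.
rewrite !TE; set s := 1 + cos t in s0 TE *; set d := 1 - cos t in d0 u1b u2b TE *.
move=> u2E u1E.
pose w := a1 u1 - a2 u1.
have uw : u2 - u1 = R2 (s%:C%C *: w).
  rewrite -[LHS]R2K TE (linB al2) !scalerBr addrACA u2E -opprD -u1E.
  by rewrite opprD addrACA subrr addr0 -scalerBr.
have aw : a1 u1 - a2 u2 = d%:C%C *: R2 w.
  have sn0 : s%:C%C != 0 :> R[i] by rewrite -[0]/(0%:C%C) (inj_eq (@complexI R)) gt_eqF.
  apply: (scalerI sn0); rewrite scalerBr.
  have -> : s%:C%C *: a1 u1 = v - d%:C%C *: u1 by rewrite -u1E addrK.
  have -> : s%:C%C *: a2 u2 = v - d%:C%C *: u2 by rewrite -u2E addrK.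
  rewrite opprB addrC addrA subrK -scalerBr uw (linZ R2b.1).
  by rewrite !scalerA mulrC.
rewrite aw nrmZR gtr0_norm //.
have h1 := u2b w; have h2 : nrm w <= ep * nrm u1 by exact: aep.
have h3 : nrm w <= ep * ((c * d)^-1 * nrm v).
  by apply: le_trans h2 _; rewrite ler_wpM2l.
have cd0 : 0 < c * d by rewrite mulr_gt0.
have h4 : nrm (R2 w) <= (c * d)^-1 * (ep * ((c * d)^-1 * nrm v)).
  by apply: le_trans h1 _; rewrite ler_wpM2l // invr_ge0 ltW.
have := ler_wpM2l (_ : 0 <= 2 * d) h4; rewrite mulrA => /(_ _)/le_trans; apply.
  by rewrite mulr_ge0 // ltW.
rewrite le_eqVlt; apply/orP; left; apply/eqP; field.
by rewrite !gt_eqF.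
Qed.

End Perturbation.

Section Path.
Context {R : realType} {H : hilbertType R} (a : H -> H) (M c : R).
Hypotheses (al : linear a) (M0 : 0 <= M) (aM : bnd a M) (c01 : 0 < c <= 1)
  (ac : sect c a).
Implicit Types (u v : H) (b : H -> H) (s t : R).

Let c0 : 0 < c. Proof. by case/andP: c01. Qed.
Let c1 : c <= 1. Proof. by case/andP: c01. Qed.
Let M10 : 0 <= 1 + M. Proof. by rewrite addr_ge0. Qed.
Let k01 : 0 <= (7 / 8 : R) < 1. Proof. by apply/andP; split; lra. Qed.

Lemma linear_path t : linear (path_op t a).
Proof.
by apply: linear_add; apply: linear_scale => //; exact: linear_id.
Qed.

Lemma path_bnd t : 0 <= t <= 1 -> bnd (path_op t a) (1 + M).
Proof.
move=> /andP[t0 t1] v; apply: le_trans (nrmD _ _) _; rewrite !nrmZR.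
rewrite !ger0_norm ?subr_ge0 // [leRHS]mulrDl mul1r; have := aM v; have := nrm_ge0 (a v).
have := nrm_ge0 v => v0 av0 avM; apply: lerD.
  by rewrite ler_piMl // gerBl.
by apply: le_trans avM; rewrite ler_piMl.
Qed.

Lemma path_sect_lower t : 0 <= t <= 1 -> lower_sect c (path_op t a).
Proof.
move=> t01; apply: sect_lower (ltW c0) _ => v s s0.
apply: le_trans (sect_path v c1 ac t01 s0); rewrite ler_wpM2r ?sqr_ge0 //.
by rewrite ler_wpM2l ?(ltW c0) // lerDr subr_ge0; case/andP: t01.
Qed.

Lemma path_dist s t : bnd (path_op s a \- path_op t a) (`|s - t| * (1 + M)).
Proof.
move=> v; rewrite /= /path_op opprD addrACA -!scalerBl.
rewrite -!rmorphB /= (_ : 1 - s - (1 - t) = - (s - t)); last by ring.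
rewrite rmorphN scaleNr addrC -scalerBr nrmZR -mulrA ler_wpM2l //.
apply: le_trans (nrmD _ _) _; rewrite nrmN mulrDl mul1r addrC lerD2l; exact: aM.
Qed.

(** [L] may depend on [n]: convergence in [n] is uniform along the segment, so continuity for one
    large [n] is enough for continuity of the limit. *)
Lemma coth_path_lip n t : 0 < t < pi -> exists2 L, 0 <= L &
  forall s1 s2, 0 <= s1 <= 1 -> 0 <= s2 <= 1 ->
    bnd (coth_avg (path_op s1 a) n t \- coth_avg (path_op s2 a) n t) (L * `|s1 - s2|).
Proof.
elim: n t => [|n IH] t t0.
  have [_ d0] := cos_lt1 t0.
  exists (2 / (c ^+ 2 * (1 - cos t)) * (1 + M)) => [|s1 s2 s10 s20].
    by rewrite mulr_ge0 // divr_ge0 // mulr_ge0 ?sqr_ge0 // ltW.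
  have h := coth_avg0_perturb (linear_path s1) M10 (path_bnd s10) (path_sect_lower s10)
    (linear_path s2) M10 (path_bnd s20) (path_sect_lower s20) c01 _ (path_dist s1 s2) t0.
  rewrite -[X in bnd _ X]mulrA [(1 + M) * _]mulrC; apply: h; exact: mulr_ge0.
have [t1 t2] := half_range t0.
have [L1 L10 h1] := IH _ t1; have [L2 L20 h2] := IH _ t2.
exists ((L1 + L2) / 2) => [|s1 s2 s10 s20 v]; first by rewrite divr_ge0 ?addr_ge0.
rewrite /= !(coth_avgS (linear_path _) M10 (path_bnd _) c01 (path_sect_lower _)) //.
rewrite -scalerBr opprD addrACA.
apply: nrm_half_sum (h1 s1 s2 s10 s20 v) (h2 s1 s2 s10 s20 v) _ => /=.
by move: `|s1 - s2| (nrm v) => d y; lra.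
Qed.

Let C := newton_const (1 + M) c.

Lemma path_limit : exists B : R -> H -> H, forall t, 0 <= t <= 1 ->
  [/\ linear (B t),
    forall n, bnd (newton_op (path_op t a) n.+1 \- B t) (C * (7 / 8) ^+ n) &
    forall n, bnd (coth_avg (path_op t a) n (pi / 2) \- B t) (C * (7 / 8) ^+ n)].
Proof.
suff /choice[B BP] : forall t, exists b, 0 <= t <= 1 -> [/\ linear b,
    forall n, bnd (newton_op (path_op t a) n.+1 \- b) (C * (7 / 8) ^+ n) &
    forall n, bnd (coth_avg (path_op t a) n (pi / 2) \- b) (C * (7 / 8) ^+ n)].
  by exists B.
move=> t; have [t01|_] := boolP (0 <= t <= 1); last by exists id.
have [b bP] := newton_limit (linear_path t) M10 (path_bnd t01) c01 (path_sect_lower t01).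
by exists b.
Qed.

Lemma path0 : path_op 0 a = id.
Proof. by apply/funext => v; rewrite /path_op subr0 scale1r scale0r addr0. Qed.

Lemma path1 : path_op 1 a = a.
Proof. by apply/funext => v; rewrite /path_op subrr scale1r scale0r add0r. Qed.

Let t00 : 0 <= (0 : R) <= 1. Proof. by rewrite lexx ler01. Qed.

Lemma newton_op_path0 n : newton_op (path_op 0 a) n = id.
Proof.
have h1 := linear_path 0; have h2 := path_bnd t00; have h3 := path_sect_lower t00.
elim: n => [|n IH]; first exact: newton_op0 h1 M10 h2 c01 h3.
apply/funext => v; rewrite (newton_opS h1 M10 h2 c01 h3) IH path0.
have [_ /(_ v)] := newton_op_inverse h1 M10 h2 c01 h3 n; rewrite IH path0 => -> _.
exact: halfD.
Qed.

Section Accretive.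
Context (B : R -> H -> H) (BP : forall t, 0 <= t <= 1 ->
  [/\ linear (B t),
    forall n, bnd (newton_op (path_op t a) n.+1 \- B t) (C * (7 / 8) ^+ n) &
    forall n, bnd (coth_avg (path_op t a) n (pi / 2) \- B t) (C * (7 / 8) ^+ n)]).

Let C0 : 0 <= C. Proof. exact: newton_const_ge0 M10 c01. Qed.

Lemma path_limit_continuous e : 0 < e -> exists2 eta, 0 < eta &
  forall s t, 0 <= s <= 1 -> 0 <= t <= 1 -> `|s - t| < eta -> bnd (B s \- B t) e.
Proof.
move=> e0; have e4 : 0 < e / 4 by rewrite divr_gt0.
have [n /(_ n (leqnn n)) ne] := expr_small k01 C0 e4.
have [L L0 Lb] := coth_path_lip n (@pihalf_range R).
exists (e / 4 / (L + 1)) => [|s t s01 t01 st v]; first by rewrite divr_gt0 // ltr_wpDl.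
have [_ _ /(_ n v) h1] := BP s01; have [_ _ /(_ n v) h2] := BP t01.
have h3 := Lb s t s01 t01 v; rewrite /= in h1 h2 h3 *.
have h4 := nrmB (B s v) (coth_avg (path_op s a) n (pi / 2) v) (B t v).
have h5 := nrmB (coth_avg (path_op s a) n (pi / 2) v) (coth_avg (path_op t a) n (pi / 2) v) (B t v).
rewrite (nrmBC (B s v) (coth_avg _ _ _ _)) in h4.
have v0 := nrm_ge0 v.
have Ls : L * `|s - t| <= e / 4.
  move: st; rewrite ltr_pdivlMr ?ltr_wpDl // => /ltW; apply: le_trans.
  by rewrite mulrC ler_wpM2l // lerDl.
have g1 := le_trans h1 (ler_wpM2r v0 (ltW ne)).
have g2 := le_trans h2 (ler_wpM2r v0 (ltW ne)).
have g3 := le_trans h3 (ler_wpM2r v0 Ls).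
have g4 := mulr_ge0 (ltW e0) v0.
apply: le_trans h4 _; apply: le_trans (lerD g1 (le_trans h5 (lerD g3 g2))) _.
lra.
Qed.

Lemma path_limit0 v : B 0 v = v.
Proof.
have [_ h _] := BP t00; apply/eqP; rewrite -subr_eq0; apply/eqP.
apply: (@nrm_le0 _ _ _ (C * nrm v)) => [|n]; first exact: mulr_ge0 C0 (nrm_ge0 v).
by have := h n v; rewrite /= newton_op_path0 nrmBC mulrAC.
Qed.

(** Before the endpoint the form of [path_op t a] has distance at least [c (1 - t)] from the
    nonpositive half-line (relative to [|v|^2]), so an accretive root is even strictly accretive. *)
Lemma path_limit_gap t : 0 <= t < 1 -> (forall v, 0 <= ip (B t v) v) ->
  exists2 e, 0 < e & forall v, e * nrm v ^+ 2 <= ip (B t v) v.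
Proof.
move=> /andP[t0 t1] B0; have t01 : 0 <= t <= 1 by rewrite t0 ltW.
have [Bl BX BZ] := BP t01.
have h1 := linear_path t; have h2 := path_bnd t01; have h3 := path_sect_lower t01.
have [N N0 BN] := bounded_operator_bnd (bounded_limit h1 M10 h2 c01 h3 Bl BX).
have d0 : 0 < c * (1 - t) by rewrite mulr_gt0 // subr_gt0.
apply: (accretive_sqrt_gap Bl N0 BN (limit_sqr h1 M10 h2 c01 h3 Bl BX BZ) B0 d0).
move=> v s s0; apply: le_trans (sect_path v c1 ac t01 s0).
by rewrite ler_wpM2r ?sqr_ge0 // ler_wpM2l ?(ltW c0) // lerDl.
Qed.

Lemma ip_dist s t (e : R) v : bnd (B s \- B t) e ->
  ip (B t v) v - e * nrm v ^+ 2 <= ip (B s v) v.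
Proof.
move=> /(_ v) /= h; have := ip_bound (B s v - B t v) v.
rewrite ipDl ipNl ler_norml => /andP[h1 _].
have := ler_wpM2r (nrm_ge0 v) h; lra.
Qed.

Lemma path_limit_accretive v : 0 <= ip (B 1 v) v.
Proof.
pose P t := forall v, 0 <= ip (B t v) v.
pose S := [set t | 0 <= t <= 1 /\ forall s, 0 <= s <= t -> P s].
have P0 : P 0 by move=> u; rewrite path_limit0 ip_norm sqr_ge0.
have S0 : S 0.
  by split=> // s s0; rewrite (_ : s = 0) //; apply/le_anti; rewrite andbC.
have Sub : has_sup S by split; [exists 0|exists 1 => t [/andP[]]].
set T := sup S.
have T0 : 0 <= T by apply: sup_upper_bound.
have T1 : T <= 1 by apply: ge_sup; [exists 0|move=> t [/andP[]]].
have Plt s : 0 <= s < T -> P s.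
  move=> /andP[s0 sT]; have [t [t01 tP] st] := sup_gt (proj1 Sub) sT.
  by apply: tP; rewrite s0 ltW.
(* Closedness: arbitrarily close to [T] there are parameters with an accretive limit; the start 0
   serves when [T] is near it. *)
have PT : P T.
  move=> u; apply/ler_addgt0Pr => e e0.
  have [e' e'0 e'e] : exists2 e', 0 < e' & e' * nrm u ^+ 2 <= e.
    exists (e / (nrm u ^+ 2 + 1)); first by rewrite divr_gt0 // ltr_wpDl ?sqr_ge0.
    rewrite mulrAC ler_pdivrMr ?ltr_wpDl ?sqr_ge0 // ler_pM2l // lerDl //.
  have [eta eta0 etaP] := path_limit_continuous e'0.
  have [s [s0 sT sd] Ps] : exists2 s, [/\ 0 <= s, s <= T & `|T - s| < eta] & P s.
    have [T00|Tn0] := eqVneq T 0.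
      by exists 0 => //; rewrite T00 subrr normr0.
    have Tp : 0 < T by rewrite lt_def Tn0.
    have [Te|Te] := leP T (eta / 2).
      exists 0 => //; split=> //; rewrite subr0 ger0_norm //; lra.
    exists (T - eta / 2); last by apply: Plt; apply/andP; split; lra.
    split; try lra; rewrite ger0_norm; lra.
  have h : bnd (B T \- B s) e'.
    by apply: etaP => //; rewrite ?T0 ?T1 // s0 (le_trans sT).
  have := ip_dist u h; have := Ps u; lra.
have [T1'|T1'] := ltP T 1; last first.
  by have -> : 1 = T; [apply/le_anti; rewrite T1' T1|exact: PT].
(* Openness: if [T < 1], the gap [e] at [T] survives perturbations of size [e], so accretivity
   extends beyond the supremum, a contradiction. *)
have T01 : 0 <= T < 1 by rewrite T0.
have [e e0 eP] := path_limit_gap T01 PT.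
have [eta eta0 etaP] := path_limit_continuous e0.
pose t := Num.min 1 (T + eta / 2).
have Tt : T < t by rewrite lt_min T1' ltrDl divr_gt0.
have tT : t <= T + eta / 2 by rewrite ge_min lexx orbT.
have t1 : t <= 1 by rewrite ge_min lexx.
suff : t <= T by rewrite leNgt Tt.
apply: sup_upper_bound => //; split; first by rewrite t1 andbT (le_trans T0) // ltW.
move=> s /andP[s0 st]; have [sT|Ts] := ltP s T; first by apply: Plt; rewrite s0.
have h : bnd (B s \- B T) e.
  apply: etaP; rewrite ?T0 ?T1 ?s0 ?(le_trans st) // ger0_norm; lra.
move=> u; have := ip_dist u h; have := eP u; lra.
Qed.

End Accretive.

(* The limit is accretive along the segment from the identity to [a]: its real
   part is positive at the identity, depends continuously on the parameter and
   cannot become singular before the endpoint. *)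
Lemma accretive_newton_limit : exists b, [/\ linear b,
  forall n, bnd (newton_op a n.+1 \- b) (C * (7 / 8) ^+ n),
  forall n, bnd (coth_avg a n (pi / 2) \- b) (C * (7 / 8) ^+ n) &
  forall v, 0 <= ip (b v) v].
Proof.
have [B BP] := path_limit; have t11 : 0 <= (1 : R) <= 1 by rewrite lexx ler01.
have [Bl BX BZ] := BP 1 t11; rewrite path1 in BX BZ.
by exists (B 1); split=> // v; exact: (path_limit_accretive BP).
Qed.

End Path.

(** * Uniqueness, spectrum and sectorial angle *)

Section AccretiveOperators.
Context {R : realType} {H : hilbertType R}.
Implicit Types (u v w : H) (a b c : H -> H).

Lemma accretive_ip b v : linear b -> accretive b -> 0 <= ip (b v) v.
Proof.
move=> bl ba; have [v0|v0] := eqVneq (nrm v) 0.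
  by rewrite (nrm_eq0 v0) (lin0 bl) ip_norm nrm0 expr0n.
have /= := ba _ (numrange_inner bl v0); rewrite ReR pmulr_rge0 //.
by rewrite invr_gt0 exprn_gt0 // lt_def v0 nrm_ge0.
Qed.

(** Equality case of Cauchy-Schwarz: a vector on which the form of an accretive operator vanishes
    lies in the radical of its symmetric part. *)
Lemma ip_skew b w v : linear b -> (forall u, 0 <= ip (b u) u) ->
  ip (b w) w = 0 -> ip (b w) v = - ip (b v) w.
Proof.
move=> bl b0 bw; have := ip_quad w v bl b0; rewrite bw mulr0 mul0r.
by move=> h; apply/eqP; rewrite -addr_eq0 -sqrf_eq0; apply/eqP/le_anti; rewrite h sqr_ge0.
Qed.

(** The difference [w = b v - c v] is killed by [b + c], so both accretive forms vanish at [w].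
    Skewness then gives [inner (a w) w = - |b w|^2], which sectoriality permits only if [b w = 0].
    Now [c w = 0] too, and skewness makes [b v] and [c v] orthogonal to [w] for [ip], hence [w] to
    itself. *)
Lemma accretive_sqrt_unique (k : R) a b c : 0 < k -> sect k a ->
  linear b -> linear c -> (forall v, b (b v) = a v) -> (forall v, c (c v) = a v) ->
  (forall v, 0 <= ip (b v) v) -> (forall v, 0 <= ip (c v) v) ->
  (forall v, b (c v) = c (b v)) -> b = c.
Proof.
move=> k0 ak bl cl ba ca b0 c0 bc; apply/funext => v.
apply/eqP; rewrite -subr_eq0; apply/eqP; set w := b v - c v.
have bcw : b w + c w = 0.
  by rewrite /w (linB bl) (linB cl) ba ca bc addrA subrK subrr.
have [bw cw] : ip (b w) w = 0 /\ ip (c w) w = 0.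
  have : ip (b w + c w) w = 0 by rewrite bcw -(scale0r w) ipZl mul0r.
  by rewrite ipDl; have := b0 w; have := c0 w; split; lra.
have aw : inner (a w) w + (nrm (b w) ^+ 2)%:C%C = 0.
  have h1 := ip_skew (b w) bl b0 bw; rewrite ip_norm ba in h1.
  have h2 := ip_skew ('i%C *: b w) bl b0 bw.
  rewrite ipir inn_norm (linZ bl) ba ipil opprK /= in h2.
  by apply/eqP; rewrite eq_complex ReD ImD /= -h2 h1 /ip addr0 addrN !eqxx.
have bw0 : b w = 0.
  have [w0|w0] := eqVneq (nrm w) 0; first by rewrite (nrm_eq0 w0) (lin0 bl).
  have wp : 0 < nrm w ^+ 2 by rewrite exprn_gt0 // lt_def w0 nrm_ge0.
  have := ak w (nrm (b w) ^+ 2 / nrm w ^+ 2) (divr_ge0 (sqr_ge0 _) (ltW wp)).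
  rewrite -mulrA divfK ?gt_eqF // aw /cnrm normr0 /= pmulr_rle0 // => h.
  by apply: nrm_eq0; apply/eqP; rewrite -sqrf_eq0; apply/eqP/le_anti; rewrite h sqr_ge0.
have cw0 : c w = 0 by move: bcw; rewrite bw0 add0r.
have z u : ip 0 u = 0 by rewrite -(scale0r w) ipZl mul0r.
have := ip_skew v bl b0 bw; have := ip_skew v cl c0 cw.
rewrite bw0 cw0 z => h1 h2.
apply: nrm_eq0; apply/eqP; rewrite -sqrf_eq0 -ip_norm {1}/w ipDl ipNl.
by apply/eqP; lra.
Qed.

Lemma sector_of_re (z : R[i]) : 0 <= complex.Re z -> sector (pi / 2) z.
Proof.
move=> z0; have [zz|zn] := eqVneq (cnrm z) 0; first by left; exact: cnrm_eq0.
have zp : 0 < cnrm z by rewrite lt_def zn cnrm_ge0.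
right; pose y := complex.Im z / cnrm z.
have y2 : y ^+ 2 <= 1.
  rewrite /y exprMn exprVn ler_pdivrMr ?exprn_gt0 // mul1r cnrmE lerDr sqr_ge0.
  by [].
have y1 : -1 <= y <= 1.
  by rewrite -ler_norml -(ler_pXn2r (n := 2)) ?nnegrE // expr1n real_normK ?num_real.
exists (cnrm z), (asin y); split => //.
  by rewrite ler_norml asin_geNpi2 // asin_lepi2.
rewrite asinK ?in_itv //= cos_asin // /y mulrCA mulfV // mulr1.
have -> : 1 - (complex.Im z / cnrm z) ^+ 2 = (complex.Re z / cnrm z) ^+ 2.
  have := cnrmE z => E; rewrite !exprMn !exprVn -[1](@mulfV _ (cnrm z ^+ 2)).
    by rewrite -mulrBl E addrK.
  by rewrite expf_eq0.
rewrite sqrtr_sqr ger0_norm ?divr_ge0 ?cnrm_ge0 // mulrCA mulfV // mulr1.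
by case: (z).
Qed.

(** If [Re l < 0], then [b - i Im l] is still accretive, since imaginary multiples of the identity
    do not change [ip (b v) v]. It satisfies [lower_sect] with constant 1, and [resolvent] applies
    at [- Re l > 0]. *)
Lemma accretive_spectrum b : bounded_operator b -> (forall v, 0 <= ip (b v) v) ->
  spectrum b `<=` sector (pi / 2).
Proof.
move=> bb b0 l bl; apply: sector_of_re; rewrite leNgt; apply/negP => l0; apply: bl.
have [N N0 bN] := bounded_operator_bnd bb.
pose y := ((- complex.Im l)%:C * 'i)%C : R[i].
pose A := b \+ (fun v => y *: v).
have Al : linear A.
  by apply: linear_add; [exact: bb.1|apply: linear_scale; exact: linear_id].
have AN : bnd A (N + cnrm y).
  by move=> v; apply: le_trans (nrmD _ _) _; rewrite mulrDl nrmZ lerD2r.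
have As : lower_sect 1 A.
  move=> s v s0; rewrite mul1r; have [v0|v0] := eqVneq (nrm v) 0.
    by rewrite v0 mulr0 nrm_ge0.
  have vp : 0 < nrm v by rewrite lt_def v0 nrm_ge0.
  rewrite -(ler_pM2r vp); apply: le_trans (ip_bound _ _).
  apply: le_trans (ler_norm _); rewrite !ipDl ipZl ip_norm.
  have -> : ip (y *: v) v = 0.
    rewrite /y -scalerA ipZl ipil inn_norm /= oppr0 mulr0.
    by [].
  by have := b0 v; lra.
have lp : 0 < - complex.Re l by rewrite oppr_gt0.
have [||g [gb gK Kg] _] := resolvent Al _ AN _ As lp.
- by rewrite addr_ge0 ?cnrm_ge0.
- by rewrite lexx ltr01.
have E : (fun v => b v - l *: v) = (fun v => A v + (- complex.Re l)%:C%C *: v).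
  apply/funext => v; rewrite /A /= -addrA -scalerDl -scaleNr; congr (_ + _ *: _).
  by rewrite /y; case: (l) => p q; apply/eqP; rewrite eq_complex /= !mulr0 !mul0r !mulr1 !addr0 !subr0 !add0r !eqxx.
rewrite E; split; last by exists g.
have Asl : linear (fun v => A v + (- complex.Re l)%:C%C *: v).
  by apply: linear_add => //; apply: linear_scale; exact: linear_id.
apply: (bnd_bounded_operator (M := N + cnrm y + cnrm (- complex.Re l)%:C%C)) => //.
by move=> v; apply: le_trans (nrmD _ _) _; rewrite mulrDl nrmZ lerD2r; exact: AN.
Qed.

End AccretiveOperators.

Section SectorialAngle.
Context {R : realType} {H : hilbertType R}.

(** The least angle is attained: for nonzero [z] all admissible arguments have the same absolute
    value, as cosine is injective on [[0, pi]], so a bound by every [r] in [S] is a bound by the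
    infimum. *)
Lemma sector_inf (S : set R) (z : R[i]) : S !=set0 ->
  (forall r, S r -> 0 <= r < pi /\ sector r z) -> sector (inf S) z.
Proof.
move=> [r1 Sr1] SP; have [-> //|z0] := eqVneq z 0; first by left.
have [/andP[r10 r1p]] := SP _ Sr1; case=> [zz|[r [t [rp tr zE]]]].
  by rewrite zz eqxx in z0.
right; exists r, t; split=> //; apply: lb_le_inf; first by exists r1.
move=> r2 Sr2; have [/andP[r20 r2p]] := SP _ Sr2; case=> [zz|[r' [t' [rp' tr' zE']]]].
  by rewrite zz eqxx in z0.
have rr (s x : R) : 0 < s -> cnrm (s * cos x +i* (s * sin x))%C = s.
  move=> s0; apply: (@pexpIrn _ 2) => //; rewrite ?nnegrE ?cnrm_ge0 ?(ltW s0) //.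
  by rewrite cnrmE /= !exprMn -mulrDr cos2Dsin2 mulr1.
have rE : r = r' by rewrite -(rr r t rp) -zE zE' rr.
have ct : cos t = cos t'.
  have : r * cos t = r' * cos t' by have := congr1 (@complex.Re R) (etrans (esym zE) zE').
  by rewrite -rE => /mulfI; apply; rewrite gt_eqF.
have -> : `|t| = `|t'|.
  apply: cos_inj; rewrite ?in_itv /= ?normr_ge0 /= ?cos_norm //.
    by rewrite (le_trans tr) // ltW.
  by rewrite (le_trans tr') // ltW.
exact: tr'.
Qed.

Lemma sectorial_angle_exists (a : H -> H) th : 0 <= th < pi ->
  numrange a `<=` sector th -> exists rho, sectorial_angle a rho.
Proof.
move=> th0 ath; pose S := [set r | 0 <= r < pi /\ numrange a `<=` sector r].
have Sth : S th by [].
have Slb : lbound S 0 by move=> r [/andP[]].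
exists (inf S); split.
- apply/andP; split; first by apply: lb_le_inf => //; exists th.
  apply: (@le_lt_trans _ _ th); last by case/andP: th0.
  by apply: ge_inf => //; exists 0.
- move=> z az; apply: sector_inf => [|r [r0 ar]]; first by exists th.
  by split=> //; exact: ar.
- by move=> r r0 ar; apply: ge_inf => //; exists 0.
Qed.

End SectorialAngle.

(** * Crouzeix constants are positive *)

Section ComplexLine.
Context {R : realType}.

Lemma Im_le_cnrm (z : R[i]) : `|complex.Im z| <= cnrm z.
Proof.
rewrite -(ler_pXn2r (n := 2)) ?nnegrE ?cnrm_ge0 //.
by rewrite real_normK ?num_real // cnrmE lerDr sqr_ge0.
Qed.

Lemma ImB (x y : R[i]) : complex.Im (x - y) = complex.Im x - complex.Im y.
Proof. by case: x y => ? ? []. Qed.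

Lemma complex_complete (F : set_system R[i]^o) : ProperFilter F -> cauchy F -> cvg F.
Proof.
move=> FF Fc.
have part (g : R[i] -> R) : (forall z w, `|g z - g w| <= cnrm (z - w)) -> cvg (g @ F).
  move=> gl; apply: cauchy_cvg; apply: cauchy_exP => e e0.
  have [|z Fz] := (cauchyP _).1 Fc e%:C%C; first by rewrite -[0]/(0%:C%C) ltcR.
  exists (g z); suff : F (g @^-1` ball (g z) e) by [].
  apply: filterS Fz => w; rewrite -!ball_normE /= => h.
  apply: le_lt_trans (gl _ _) _.
  have {}h : `|(z - w : R[i])| < e%:C%C by exact: h.
  by move: h; rewrite cnormE ltcR.
have /cvg_ex[x Fx] : cvg ((@complex.Re R) @ F).
  by apply: part => z w; rewrite -ReB Re_le_cnrm.
have /cvg_ex[y Fy] : cvg ((@complex.Im R) @ F).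
  by apply: part => z w; rewrite -ImB Im_le_cnrm.
apply/cvg_ex; exists (x +i* y)%C; apply/fcvg_ballP => e e0.
have [Ie e'0] : complex.Im e = 0 /\ 0 < complex.Re e.
  by move: e0; rewrite ltcE /= => /andP[/eqP].
have -> : e = (complex.Re e)%:C%C by case: (e) Ie => p q /= ->.
move: (complex.Re e) e'0 => {e0 Ie}e e0; have e20 : 0 < e / 2 by rewrite divr_gt0.
have hx : F [set z | ball x (e / 2) (complex.Re z)] by exact: cvg_ball Fx _ e20.
have hy : F [set z | ball y (e / 2) (complex.Im z)] by exact: cvg_ball Fy _ e20.
suff : F (ball (x +i* y : R[i]^o)%C e%:C%C) by [].
apply: filterS (filterI hx hy) => z; rewrite -!ball_normE /= => -[{}hx {}hy].
suff : `|((x +i* y)%C - z : R[i])| < e%:C%C by [].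
rewrite cnormE ltcR.
rewrite (_ : (x +i* y)%C - z = (x - complex.Re z)%:C%C + 'i%C * (y - complex.Im z)%:C%C).
  apply: le_lt_trans (cnrmD _ _) _; rewrite cnrmM !cnrmR.
  have -> : cnrm ('i%C : R[i]) = 1 by rewrite /cnrm normc_def /= expr0n add0r expr1n sqrtr1.
  lra.
by rewrite [LHS]complexE ReB ImB.
Qed.

(* [R[i]^o] cannot carry the complete structure itself: the canonical instance
   attached to [_^o] is the one for real types. *)
Definition cline : Type := R[i]^o.
HB.instance Definition _ := NormedModule.copy cline R[i]^o.
HB.instance Definition _ := Uniform_isComplete.Build cline complex_complete.

Definition cinner (x y : cline) : R[i] := x * Num.conj (y : R[i]).

Lemma cinner_bilinear : bilinear_for *%R (Num.conj \; *%R) cinner.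
Proof.
split=> u a x y; rewrite /cinner /=.
  by rewrite mulrDl -mulrA.
by rewrite rmorphD rmorphM mulrDr mulrCA.
Qed.
HB.instance Definition _ := @bilinear_isBilinear.Build R[i] cline cline R[i]
  *%R (Num.conj \; *%R) cinner cinner_bilinear.

Lemma cinner_hermitian (x y : cline) :
  cinner x y = (-1) ^+ false * Num.conj (cinner y x).
Proof.
rewrite /cinner expr0 mul1r rmorphM mulrC; congr (_ * _).
exact: esym (conjCK (x : R[i])).
Qed.
HB.instance Definition _ := @isHermitianSesquilinear.Build R[i] cline
  false Num.conj cinner cinner_hermitian.

Lemma cinner_gt0 (x : cline) : x != 0 -> 0 < cinner x x.
Proof. by move=> x0; rewrite /cinner -normCK exprn_gt0 // normr_gt0. Qed.
HB.instance Definition _ := @isDotProduct.Build R[i] cline cinner cinner_gt0.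

Lemma cinner_norm (x : cline) : `|x| ^+ 2 = cinner x x.
Proof. by rewrite /cinner -normCK. Qed.

HB.instance Definition _ :=
  CompleteNormedModule_isHilbert.Build R cline cinner_norm.

(** Testing [p = q = 1] on the identity gives [K >= 1]. The given Hilbert space may be zero, hence
    the test on the complex line. Positivity of [K] is what makes the final inequality strict. *)
Lemma crouzeix_gt0 (K : R) : crouzeix_constant K -> 0 < K.
Proof.
move=> cK; pose H : hilbertType R := cline.
have xb : bounded_operator (fun v : H => v).
  apply: (bnd_bounded_operator (M := 1)); first exact: linear_id.
  by move=> v; rewrite mul1r.
have v1 : nrm (1 : H) = 1 by have := cnrmR (1 : R); rewrite normr1.
have E : op_poly 1 (fun v : H => v) = id by apply/funext => v; rewrite op_poly1.
have iE : op_inv (id : H -> H) = id by apply: op_inv_unique; split.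
have n0 (z : R[i]) : (1 : {poly R[i]}).[z] != 0 by rewrite hornerC oner_neq0.
have := cK H _ 1 1 xb (oner_neq0 _) (fun z _ => n0 z); rewrite E iE.
set S := [set _ | _ in _].
have -> : S = [set 1].
  have oneE (z : R[i]) : complex.Re `|(1 : {poly R[i]}).[z] / (1 : {poly R[i]}).[z]| = 1.
    by rewrite !hornerC divr1 normr1.
  apply/seteqP; split=> [_ [z _ <-]|_ ->]; first by rewrite oneE.
  have nz : nrm (1 : H) != 0 by rewrite v1 oner_neq0.
  by exists ((nrm (1 : H) ^- 2)%:C%C * inner (1 : H) (1 : H)); [exact: numrange_inner nz|exact: oneE].
rewrite sup1 mulr1 => h.
have := bnd_opnorm xb (1 : H); rewrite v1 mulr1 => h1.
exact: lt_le_trans ltr01 (le_trans h1 h).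
Qed.

End ComplexLine.

(** * Rate of convergence *)

Section ScalarRate.
Context {R : realType}.

Lemma horner2 (z : R[i]) : (2%:R : {poly R[i]}).[z] = 2%:R.
Proof. by rewrite -polyC_natr hornerC. Qed.

(** Taking the root [w] as the variable avoids choosing a branch. *)
Lemma newton_poly_sqr n (w : R[i]) :
  (nump n).[w ^+ 2] + w * (denp n).[w ^+ 2] = (1 + w) ^+ (2 ^ n) /\
  (nump n).[w ^+ 2] - w * (denp n).[w ^+ 2] = (1 - w) ^+ (2 ^ n).
Proof.
elim: n => [|n [IH1 IH2]]; first by rewrite /nump /denp /= !hornerC mulr1 !expr1.
rewrite numpS denpS !(horner2, hornerD, horner_exp, hornerM, hornerX).
rewrite expnSr !exprM -IH1 -IH2; move: (nump n).[_] (denp n).[_] => P Q.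
by split; ring.
Qed.

Lemma denp0 n : (denp n).[0] = (2 ^ n)%:R :> R[i].
Proof.
have P0 m : (nump m).[0] = 1 :> R[i].
  elim: m => [|m IH]; first by rewrite hornerC.
  by rewrite numpS !(hornerD, horner_exp, hornerM, hornerX) IH mul0r addr0 expr1n.
elim: n => [|n IH]; first by rewrite hornerC.
by rewrite denpS !hornerM horner2 P0 IH expnS natrM mulr1.
Qed.

Lemma exprD_ge1 (A D : R) m : 0 <= A -> 0 <= D ->
  A ^+ m.+1 + m.+1%:R * A ^+ m * D <= (A + D) ^+ m.+1.
Proof.
move=> A0 D0; elim: m => [|m IH]; first by rewrite !expr1 expr0 !mul1r.
rewrite (exprS (A + D)); apply: le_trans (ler_wpM2l (addr_ge0 A0 D0) IH).
have := mulr_ge0 (mulr_ge0 (ler0n R m.+1) (exprn_ge0 m A0)) (sqr_ge0 D).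
rewrite (exprS A m.+1) (exprS A m) -(natr1 m.+1).
by move: (A ^+ m) (m.+1%:R : R) => k x; lra.
Qed.

Lemma exprD_ge2 (A D : R) m : 0 <= A -> 0 <= D ->
  A ^+ m.+2 + (m.+2 * m.+1)%:R / 2 * A ^+ m * D ^+ 2 <= (A + D) ^+ m.+2.
Proof.
move=> A0 D0; elim: m => [|m IH].
  rewrite expr0 muln1 divff ?pnatr_eq0 // !mul1r.
  by have := mulr_ge0 A0 D0; lra.
rewrite (exprS (A + D)) [leRHS]mulrDl.
have h1 := ler_wpM2l A0 IH; have h2 := ler_wpM2l D0 (exprD_ge1 m.+1 A0 D0).
apply: (le_trans _ (lerD h1 h2)).
have k0 : 0 <= A ^+ m by exact: exprn_ge0.
have := mulr_ge0 D0 (mulr_ge0 A0 (mulr_ge0 A0 k0)).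
rewrite !natrM -(natr1 m.+2) -(natr1 m.+1) -(natr1 m) !(exprS A).
move: (A ^+ m) (m%:R : R) => k x; lra.
Qed.

(* With [w = sqrt z], [A = |1 - w|^2] and [A + 4 Re w = |1 + w|^2]: for
   [|w| <= 2 k] one has [A <= 1] and Bernoulli's inequality suffices; for
   [|w| >= 2 k] the second order term wins once [m] is large. *)
Lemma rate_real (k B r x : R) m : 0 < k -> 0 <= r <= B -> k * r <= x ->
  0 <= 1 - 2 * x + r ^+ 2 -> (1 + B) ^+ 4 <= 4 * k ^+ 2 * m.+1%:R ->
  4 * k * r * m.+2%:R * (1 - 2 * x + r ^+ 2) ^+ m.+2 <=
    (1 - 2 * x + r ^+ 2 + 4 * x) ^+ m.+2 - (1 - 2 * x + r ^+ 2) ^+ m.+2.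
Proof.
move=> k0 /andP[r0 rB] krx A0 mB.
set A := 1 - 2 * x + r ^+ 2 in A0 *; set D := 4 * x.
have kr0 : 0 <= k * r by rewrite mulr_ge0 // ltW.
have D4 : 4 * (k * r) <= D by rewrite /D; lra.
have D0 : 0 <= D by lra.
have M0 : 0 <= m.+2%:R :> R by exact: ler0n.
rewrite lerBrDr addrC; have [r2k|r2k] := leP r (2 * k).
  apply: le_trans (exprD_ge1 m.+1 A0 D0); rewrite lerD2l.
  have A1 : A <= 1.
    have := ler_wpM2r r0 r2k; rewrite /A; lra.
  have Am := exprn_ge0 m.+1 A0.
  have h : A ^+ m.+2 <= A ^+ m.+1 by rewrite exprS ler_piMl.
  have h1 := ler_wpM2l (mulr_ge0 kr0 M0) h.
  have h2 := ler_wpM2l (mulr_ge0 M0 Am) D4.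
  lra.
apply: le_trans (exprD_ge2 m A0 D0); rewrite lerD2l.
have Am := exprn_ge0 m A0; have m1 : 0 <= m.+1%:R :> R by exact: ler0n.
have AB : A ^+ 2 <= (1 + B) ^+ 4.
  rewrite (exprM _ 2 2) ler_pXn2r ?nnegrE ?sqr_ge0 //.
  have := ler_pM r0 r0 rB rB; rewrite /A; lra.
have D2 : 16 * (k * r) ^+ 2 <= D ^+ 2.
  have := ler_pM (_ : 0 <= 4 * (k * r)) (_ : 0 <= 4 * (k * r)) D4 D4.
  by rewrite -expr2 => /(_ _ _)/(le_trans _); apply; rewrite ?mulr_ge0 //; lra.
have key : A ^+ 2 <= 2 * (k * r) * m.+1%:R.
  apply: le_trans AB (le_trans mB _).
  have := ler_wpM2l (mulr_ge0 (ltW k0) m1) (ltW r2k); lra.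
have h1 := ler_wpM2l (mulr_ge0 (mulr_ge0 kr0 M0) Am) key.
have h2 := ler_wpM2l (mulr_ge0 (mulr_ge0 M0 m1) Am) D2.
rewrite natrM (exprS A m.+1) (exprS A m); lra.
Qed.

(** With [N = 2^n] the error is [(1 - w)^N / Q], and [2 |w| |Q|] is at least
    [|1 + w|^N - |1 - w|^N]. By [rate_real] this difference is at least [2 k |w| N |1 - w|^N]; the
    constant [k] will be [cos (rho / 2)]. *)
Lemma newton_rate (k B : R) : 0 < k <= 1 -> 0 <= B ->
  exists n0, forall n, (n0 <= n)%N -> forall w : R[i],
    k * cnrm w <= complex.Re w -> cnrm w <= B ->
    (denp n).[w ^+ 2] != 0 /\
    cnrm ((nump n).[w ^+ 2] / (denp n).[w ^+ 2] - w) <= k^-1 / 2 ^+ n.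
Proof.
move=> /andP[k0 k1] B0; pose E := (1 + B) ^+ 4 / (4 * k ^+ 2).
have E0 : 0 <= E by rewrite divr_ge0 ?exprn_ge0 ?addr_ge0 // mulr_ge0 ?sqr_ge0.
(* [E] is the threshold required by [rate_real]; the extra units absorb the shift of [n] by one and
   the strict inequality [E < n], with room to spare. *)
exists (Num.truncn E).+3 => n nn w wk wB.
case: n nn => // n nn.
have nE : E < n%:R.
  by apply: lt_le_trans (truncnS_gt E) _; rewrite ler_nat ltnW.
have [m mE] : exists m, (2 ^ n)%N = m.+2.
  exists (2 ^ n).-2; case: n nn {nE} => // n _.
  by rewrite -[RHS]/(((2 ^ n.+1).-2).+2) !prednK // ?expn_gt0 // -ltnS prednK ?expn_gt0 // (leq_trans _ (ltn_expl n.+1 _)).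
have nm : (n <= m.+1)%N by rewrite -ltnS -mE ltn_expl.
have NE : (2 ^ n.+1)%N = (2 * m.+2)%N by rewrite expnS mE.
have N0 : 0 < 2 ^+ n.+1 :> R by rewrite exprn_gt0.
have [PQ PmQ] := newton_poly_sqr n.+1 w.
(* At [w = 0] the lower bound for [|w| |Q|] is void; there the iterate is exactly the reciprocal of
   the power of 2, and [k <= 1] suffices. *)
have [w0|w0] := eqVneq w 0.
  rewrite w0 expr0n /= mul0r !addr0 expr1n in PQ.
  rewrite w0 expr0n /= PQ denp0.
  have dn : (2 ^ n.+1)%:R = (2 ^+ n.+1)%:C%C :> R[i] by rewrite natrX rmorphXn rmorph_nat.
  rewrite dn subr0 div1r -fmorphV cnrmR ger0_norm ?invr_ge0 ?(ltW N0) //; split.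
    by rewrite -[0]/(0%:C%C) (inj_eq (@complexI R)) gt_eqF.
  by rewrite ler_peMl ?invr_ge0 ?(ltW N0) // invf_ge1.
move: (nump n.+1).[w ^+ 2] (denp n.+1).[w ^+ 2] PQ PmQ => P Q PQ PmQ.
set r := cnrm w in wk wB *.
have rp : 0 < r.
  by rewrite lt_def cnrm_ge0 andbT; apply: contra w0 => /eqP/cnrm_eq0 ->.
set x := complex.Re w in wk.
have r2 : r ^+ 2 = x ^+ 2 + complex.Im w ^+ 2 by exact: cnrmE.
have AE : cnrm (1 - w) ^+ 2 = 1 - 2 * x + r ^+ 2.
  by rewrite cnrmE ReB r2 (ImD 1 (- w)) /= add0r -/x; case: (w) => a b /=; ring.
have DE : cnrm (1 + w) ^+ 2 = 1 - 2 * x + r ^+ 2 + 4 * x.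
  by rewrite cnrmE ReD r2 ImD /= add0r -/x; ring.
have A0 : 0 <= 1 - 2 * x + r ^+ 2 by rewrite -AE sqr_ge0.
have mB : (1 + B) ^+ 4 <= 4 * k ^+ 2 * m.+1%:R.
  rewrite mulrC -ler_pdivrMr ?mulr_gt0 ?exprn_gt0 //; apply: le_trans (ltW nE) _.
  by rewrite ler_nat.
have rB : 0 <= r <= B by rewrite ltW.
have := rate_real k0 rB wk A0 mB; rewrite -DE -AE -!exprM -NE => rate.
have Q2 : cnrm (1 + w) ^+ (2 ^ n.+1) - cnrm (1 - w) ^+ (2 ^ n.+1) <= 2 * r * cnrm Q.
  rewrite -!cnrmX -PQ -PmQ lerBlDr.
  have -> : P + w * Q = (2%:R : R)%:C%C * (w * Q) + (P - w * Q) by rewrite rmorph_nat; ring.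
  by apply: le_trans (cnrmD _ _) _; rewrite !cnrmM cnrmR ger0_norm // mulrA.
have xp : 0 < x by apply: lt_le_trans wk; rewrite mulr_gt0.
have Qp : 0 < cnrm Q.
  have : 0 < 2 * r * cnrm Q.
    apply: lt_le_trans Q2; rewrite subr_gt0 NE !exprM DE AE.
    have AD : 1 - 2 * x + r ^+ 2 < 1 - 2 * x + r ^+ 2 + 4 * x.
      by rewrite ltrDl mulr_gt0.
    by rewrite ltr_pXn2r // nnegrE // (le_trans A0 (ltW AD)).
  by rewrite pmulr_rgt0 // mulr_gt0.
have Q0 : Q != 0 by apply/eqP => Q0; move: Qp; rewrite Q0 /cnrm normr0 ltxx.
split=> //.
have -> : P / Q - w = (P - w * Q) / Q by rewrite mulrBl mulfK.
rewrite PmQ cnrmM cnrmV cnrmX ler_pdivrMr // mulrAC ler_pdivlMr //.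
rewrite -[k^-1]div1r mulrAC mul1r ler_pdivlMr //.
have := le_trans rate Q2.
have -> : 2 ^+ n.+1 = 2 * m.+2%:R :> R by rewrite -natrX NE natrM.
move: (cnrm (1 - w) ^+ _) (m.+2%:R : R) (cnrm Q) => a M q h.
rewrite -(ler_pM2l (_ : 0 < 2 * r)); last by rewrite mulr_gt0.
by apply: le_trans h; rewrite le_eqVlt; apply/orP; left; apply/eqP; ring.
Qed.

End ScalarRate.

Section Rate.
Context {R : realType} {H : hilbertType R} (a b : H -> H) (M c C rho K : R).
Hypotheses (al : linear a) (M0 : 0 <= M) (aM : bnd a M) (c01 : 0 < c <= 1)
  (ac : lower_sect c a) (C0 : 0 <= C)
  (bX : forall n, bnd (newton_op a n.+1 \- b) (C * (7 / 8) ^+ n))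
  (rho0 : 0 <= rho < pi) (arho : numrange a `<=` sector rho)
  (cK : crouzeix_constant K).

Let ab : bounded_operator a := bnd_bounded_operator al aM.
Let K0 : 0 < K := crouzeix_gt0 cK.
Let k := cos (rho / 2).

Lemma cos_half_gt0 : 0 < k <= 1.
Proof.
rewrite cos_le1 andbT; apply: cos_gt0_pihalf.
by have := rho0; move=> /andP[r0 rp]; apply/andP; split; lra.
Qed.

(** Halving the argument is the origin of [rho / 2] in the constant. *)
Lemma sector_sqrt z : sector rho z ->
  exists2 w : R[i], w ^+ 2 = z & k * cnrm w <= complex.Re w.
Proof.
move=> zr; suff [w wz wr] : exists2 w : R[i], w ^+ 2 = z & sector (rho / 2) w.
  exists w => //; apply: sector_cos wr; have := rho0.
  by move=> /andP[r0 rp]; apply/andP; split; lra.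
case: zr => [->|[r [t [r0 tr ->]]]]; first by exists 0; [rewrite expr0n|left].
have s0 : 0 < Num.sqrt r by rewrite sqrtr_gt0.
exists ((Num.sqrt r * cos (t / 2)) +i* (Num.sqrt r * sin (t / 2)))%C; last first.
  right; exists (Num.sqrt r), (t / 2); split=> //.
  by rewrite normrM (ger0_norm (x := 2^-1)) ?invr_ge0 // ler_pM2r // invr_gt0.
have rE : Num.sqrt r ^+ 2 = r by rewrite sqr_sqrtr // ltW.
have ct : cos t = cos (t / 2) * cos (t / 2) - sin (t / 2) * sin (t / 2).
  by rewrite {1}(splitr t) cosD.
have st : sin t = sin (t / 2) * cos (t / 2) + cos (t / 2) * sin (t / 2).
  by rewrite {1}(splitr t) sinD.
rewrite expr2 ct st; apply/eqP; rewrite eq_complex /=.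
move: (Num.sqrt r) rE => q <-.
by apply/andP; split; apply/eqP; ring.
Qed.

Lemma numrange_bound z : numrange a z -> cnrm z <= M + 1.
Proof.
move=> az; have [v v1 h] := numrange_closed az ltr01.
have := inner_bound (a v) v; have := aM v; rewrite v1 !mulr1 => h1 h2.
have := cnrmD (z - inner (a v) v) (inner (a v) v); rewrite subrK; lra.
Qed.

(** Besides the error bound, the scalar estimate shows that the common denominator [q] has no zero
    on [W(a)] for large indices. The root [w] cancels in the difference, so it may be chosen
    separately for each [z]. *)
Lemma newton_crouzeix : exists n0, forall n m, (n0 <= n)%N -> (n0 <= m)%N ->
  bnd (newton_op a n \- newton_op a m) (K * (k^-1 / 2 ^+ n + k^-1 / 2 ^+ m)).
Proof.
have [n0 rate] := newton_rate cos_half_gt0 (addr_ge0 M0 ler01).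
have zw z : numrange a z -> exists2 w : R[i], w ^+ 2 = z &
    k * cnrm w <= complex.Re w /\ cnrm w <= M + 1.
  move=> az; have [w wz kw] := sector_sqrt (arho az); exists w => //; split=> //.
  rewrite -(ler_pXn2r (n := 2)) ?nnegrE ?cnrm_ge0 ?addr_ge0 //.
  rewrite -cnrmX wz; apply: le_trans (numrange_bound az) _.
  by have := M0; rewrite expr2 => m0; rewrite ler_peMl // ?addr_ge0 // lerDr.
have k0 : 0 < k by case/andP: cos_half_gt0.
exists n0 => n m nn mm.
have rn := regular_denp al M0 aM c01 ac n; have rm := regular_denp al M0 aM c01 ac m.
pose p : {poly R[i]} := nump n * denp m - nump m * denp n.
pose q : {poly R[i]} := denp n * denp m.
have pq : newton_op a n \- newton_op a m = opfrac a p q.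
  by apply/funext => v; rewrite /= (opfracB ab).
have q0 : q != 0.
  apply/eqP => /(congr1 (fun q => q.[0])); rewrite hornerM !denp0 horner0.
  by move/eqP; rewrite -natrM pnatr_eq0 muln_eq0 !expn_eq0.
have qz z : numrange a z -> q.[z] != 0.
  move=> az; have [w <- [h1 h2]] := zw z az.
  by rewrite hornerM mulf_neq0 //; [case: (rate n nn w h1 h2)|case: (rate m mm w h1 h2)].
have := @cK H a p q ab q0 qz; rewrite -/(opfrac a p q) => cb.
have rb : bounded_operator (opfrac a p q) by apply: (bounded_opfrac ab); exact: (regularM ab).
rewrite pq; apply: bnd_le (bnd_opnorm rb) (le_trans cb _).
rewrite ler_pM2l //; set S := [set _ | _ in _].
have e0 j : 0 <= k^-1 / 2 ^+ j by rewrite divr_ge0 ?invr_ge0 ?exprn_ge0 // ltW.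
(* The numerical range is empty when [H] is zero; [sup] then takes its default value 0. *)
have [->|S0] := eqVneq S set0; first by rewrite sup0 addr_ge0.
apply: ge_sup; first exact/set0P.
move=> _ [z az <-]; have [w wz [h1 h2]] := zw z az.
have [Qn h3] := rate n nn w h1 h2; have [Qm h4] := rate m mm w h1 h2.
rewrite wz in Qn Qm h3 h4.
have -> : p.[z] / q.[z] = ((nump n).[z] / (denp n).[z] - w) + - ((nump m).[z] / (denp m).[z] - w).
  rewrite /p /q !(hornerD, hornerN, hornerM); move: Qn Qm.
  move: (nump n).[z] (nump m).[z] (denp n).[z] (denp m).[z] => P1 P2 Q1 Q2 Q10 Q20.
  by field; rewrite Q10 Q20.
apply: le_trans (cnrmD _ _) _; apply: lerD => //.
by rewrite /cnrm normrN.
Qed.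

Lemma newton_error_rate : exists n0, forall n, (n0 <= n)%N ->
  opnorm (newton_op a n \- b) <= k^-1 * K / 2 ^+ n.
Proof.
have [n0 nP] := newton_crouzeix; exists n0 => n nn.
have k0 : 0 < k^-1 by rewrite invr_gt0; case/andP: cos_half_gt0.
have kK : 0 <= k^-1 * K by rewrite mulr_ge0 // ltW.
apply: opnorm_le; first by rewrite divr_ge0 // exprn_ge0.
move=> v; rewrite -subr_le0 /=; have v0 := nrm_ge0 v.
apply: (@le0_geo _ _ (7 / 8) ((k^-1 * K + C) * nrm v)) => [||j].
- by apply/andP; split; lra.
- by rewrite mulr_ge0 // addr_ge0.
(* For the comparison index [(n0 + j).+1], both the Crouzeix term and the convergence error are
   multiples of [(7 / 8) ^+ j], and [j] is free. *)
have h1 := nP n (n0 + j).+1 nn (leqW (leq_addr _ _)) v.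
have h2 := bX (n0 + j) v; rewrite /= in h1 h2.
have h3 := nrmB (newton_op a n v) (newton_op a (n0 + j).+1 v) (b v).
have i1 : 1 / 2 ^+ (n0 + j).+1 <= (7 / 8 : R) ^+ j.
  rewrite div1r -exprVn -addnS -addSnnS exprD.
  apply: (@le_trans _ _ (2^-1 ^+ j)).
    by rewrite ler_piMl ?exprn_ge0 ?exprn_ile1 ?invr_ge0 //; lra.
  by apply: lerXn2r; rewrite ?nnegrE; lra.
have i2 : (7 / 8 : R) ^+ (n0 + j) <= (7 / 8) ^+ j.
  by rewrite exprD ler_piMl ?exprn_ge0 ?exprn_ile1 //; lra.
have g1 := ler_wpM2l (mulr_ge0 kK v0) i1.
have g2 := ler_wpM2l (mulr_ge0 C0 v0) i2.
move: h1 h2 g1 g2; set x := 2 ^+ (n0 + j).+1; set y := (7 / 8) ^+ j; lra.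
Qed.

End Rate.

(** * The second starting point as a shift of the first, and the final estimates *)

Section MainTheorem.
Context {R : realType} {H : hilbertType R}.

Lemma newton_shift (a : H -> H) n :
  newton a (fun v => 2^-1 *: (a v + v)) n = newton a (fun v => v) n.+1.
Proof.
have iE : op_inv (fun v : H => v) = id.
  apply: op_inv_unique; split=> //.
  apply: (bnd_bounded_operator (M := 1)); first exact: linear_id.
  by move=> v; rewrite mul1r.
elim: n => [|n IH]; first by apply/funext => v; rewrite /= iE addrC.
by rewrite [LHS]/= IH.
Qed.

End MainTheorem.

Theorem theorem4p4 (R : realType) (H : hilbertType R) (a : H -> H) (theta : R)
    (ha : bounded_operator a) (htheta : 0 <= theta < pi)
    (hW : numrange a `<=` sector theta) :
  exists (b : H -> H) (rho : R),
    [/\ unique (principal_sqrt a) b,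
        sectorial_angle a rho &
        forall X0 : H -> H,
          X0 = (fun v => v) \/ X0 = (fun v => 2^-1 *: (a v + v)) ->
          [/\ forall n, invertible (newton a X0 n),
              opnorm (newton a X0 n \- b) @[n --> \oo] --> (0 : R),
              forall C K : R, (cos (rho / 2))^-1 < C -> crouzeix_constant K ->
                \forall n \near \oo,
                  opnorm (newton a X0 n \- b) < C * K / 2 ^+ n &
              accretive a -> forall K : R, crouzeix_constant K ->
                \forall n \near \oo,
                  opnorm (newton a X0 n \- b) <= K / 2 ^+ n.-1]].
Proof.
have al := ha.1; have [N N0 aN] := bounded_operator_bnd ha.
have th0 : 0 <= theta <= pi by case/andP: htheta => -> /ltW ->.
have k1 : -1 < cos theta.
  by have /andP[t0 t1] := htheta; rewrite -cospi ltr_cos ?in_itv /= ?lexx ?pi_ge0 ?t0 ?(ltW t1).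
have as_ := sect_of_cos k1 (numrange_ge al (fun z az => sector_cos th0 (hW z az))).
set c := 1 + Num.min (cos theta) 0 in as_.
have c01 : 0 < c <= 1.
  rewrite /c gerDl ge_min lexx orbT andbT -ltrBlDl sub0r.
  by rewrite lt_min k1 ltrN10.
have c0 : 0 < c by case/andP: c01.
(* The bound [1 + N] is valid along the whole segment from the identity to [a], and the constants of
   [accretive_newton_limit] are built from it. *)
have M0 : 0 <= 1 + N by rewrite addr_ge0.
have aM : bnd a (1 + N) by apply: bnd_le aN _; rewrite lerDr.
have ac := sect_lower (ltW c0) as_.
have [b [bl bX bZ b0]] := accretive_newton_limit al N0 aN c01 as_.
have bb := bounded_limit al M0 aM c01 ac bl bX.
have ba := limit_sqr al M0 aM c01 ac bl bX bZ.
have bp : principal_sqrt a b.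
  split=> //; [exact/funext|exact: accretive_spectrum|exact: accretive_of_ip].
have [rho rhoP] := sectorial_angle_exists htheta hW.
have [rho0 arho rho_min] := rhoP.
set C := newton_const (1 + N) c in bX bZ.
have C0 : 0 <= C by exact: newton_const_ge0.
exists b, rho; split=> //.
  split=> // d [db dd _ da]; have d2 v : d (d v) = a v by rewrite -dd.
  apply: (accretive_sqrt_unique c0 as_ bl db.1 ba d2 b0).
    by move=> v; exact: accretive_ip db.1 da.
  move=> v; symmetry; apply: (limit_commute al M0 aM c01 ac bX db) => w.
  by rewrite -!d2.
move=> X0 hX0.
have [s sE] : exists s, forall n, newton a X0 n = newton_op a (s + n).
  case: hX0 => ->; first by exists 0%N => n; exact: newton_opE al M0 aM c01 ac n.
  by exists 1%N => n; rewrite newton_shift; exact: newton_opE al M0 aM c01 ac n.+1.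
have rate (K : R) (cK : crouzeix_constant K) :=
  newton_error_rate al M0 aM c01 ac C0 bX rho0 arho cK.
have kap := cos_half_gt0 rho0; have kap0 : 0 < cos (rho / 2) by case/andP: kap.
have strict (D K : R) : (cos (rho / 2))^-1 < D -> crouzeix_constant K ->
    \forall n \near \oo, opnorm (newton a X0 n \- b) < D * K / 2 ^+ n.
  move=> kD cK; have K0 := crouzeix_gt0 cK; have [n0 nP] := rate K cK.
  exists n0 => // n /= nn; rewrite sE.
  apply: le_lt_trans (nP _ (leq_trans nn (leq_addl _ _))) _.
  have D0 : 0 < D by apply: lt_trans kD; rewrite invr_gt0.
  apply: (@lt_le_trans _ _ (D * K / 2 ^+ (s + n))).
    by rewrite ltr_pM2r ?invr_gt0 ?exprn_gt0 // ltr_pM2r.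
  rewrite ler_pM2l ?mulr_gt0 // lef_pV2 ?posrE ?exprn_gt0 //.
  by rewrite ler_weXn2l ?leq_addl // ler1n.
split=> //.
- move=> n; rewrite sE; split; first exact: newton_op_bounded al M0 aM c01 ac _.
  by exists (opfrac a (denp (s + n)) (nump (s + n))); exact: newton_op_inverse al M0 aM c01 ac _.
- apply/cvgrPdist_lt => e e0.
  have k01 : 0 <= (7 / 8 : R) < 1 by apply/andP; split; lra.
  have [n1 nP] := expr_small k01 C0 e0.
  exists n1.+1 => // n /= nn; rewrite sE sub0r normrN.
  have [m mE] : exists m, (s + n)%N = m.+1.
    by exists (s + n).-1; rewrite prednK // (leq_trans _ (leq_addl _ _)) // (leq_trans _ nn).
  have nm : (n1 <= m)%N by rewrite -ltnS -mE (leq_trans nn) // leq_addl.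
  have nb : bounded_operator (newton_op a (s + n) \- b).
    rewrite mE; apply: (bnd_bounded_operator (M := C * (7 / 8) ^+ m)) => //.
    move=> l u v /=; rewrite (newton_op_bounded al M0 aM c01 ac m.+1).1 bl.
    by rewrite opprD addrACA -scalerBr.
  rewrite ger0_norm ?opnorm_ge0 // mE; apply: le_lt_trans (nP m nm).
  by apply: opnorm_le => //; rewrite mulr_ge0 // exprn_ge0 //; lra.
move=> aa K cK.
have rho2 : rho <= pi / 2.
  apply: rho_min; first by have := pi_gt0 R; move=> p0; apply/andP; split; lra.
  by move=> z /aa; exact: sector_of_re.
(* As [rho <= pi / 2], the secant is at most [sqrt 2]; so 2 is an admissible constant, and
   [2 K / 2^n] is [K / 2^(n-1)]. *)
have kD : (cos (rho / 2))^-1 < 2.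
  have cr : 0 <= cos rho by apply: cos_ge0_pihalf; case/andP: rho0 => r0 _; apply/andP; split; lra.
  have h : 1 / 2 < cos (rho / 2).
    rewrite -(ltr_pXn2r (n := 2)) ?nnegrE ?(ltW kap0) //.
    have := cos_half_sq rho; lra.
  by rewrite -[_^-1]mul1r ltr_pdivrMr //; lra.
(* Starting from [n0.+1] excludes [n = 0], where [n.-1] is truncated. *)
have [n0 _ nP] := strict 2 K kD cK; exists n0.+1 => // -[//|n] /= nn.
have := nP n.+1 (ltnW nn); rewrite exprS => /ltW/le_trans; apply.
by rewrite invfM mulrACA mulfV // mul1r.
Qed.
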